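(* Consider a family of systems $\dot x=f(x,p)$, $x\in\mathbb{R}^n$, with a vector of parameters $p$ taking values in an order-convex set $\mathcal{P}\subset\mathbb{R}^m$, where $f$ is continuous in $(x,p)$ and twice continuously differentiable in $x$ for every fixed $p$. Let the system be strongly monotone on $\mathcal{D}\times\mathcal{P}$, where $\mathcal{D}=\mathcal{D}_{f(\cdot,q)}$ for all $q\in\mathcal{P}$. Consider an interval $[p_{\min},p_{\max}]$ with $p_{\min},p_{\max}\in\mathcal{P}$ such that for each $p\in\{p_{\min},p_{\max}\}$ the system $\dot x=f(x,p)$ has two asymptotically stable fixed points $x^\ast(p)$, $x^\bullet(p)$ in $\mathcal{D}$ with $\mathcal{D}=\mathrm{cl}(\mathcal{B}(x^\ast(p))\cup\mathcal{B}(x^\bullet(p)))$ and $x^\bullet(p)\succeq x^\ast(p)$, and such that $$x^\ast(p_{\min})\in\mathcal{B}(x^\ast(p_{\max})),\qquad x^\ast(p_{\max})\in\mathcal{B}(x^\ast(p_{\min})),$$ $$x^\bullet(p_{\min})\notin[x^\ast(p_{\min}),x^\ast(p_{\max})].$$ Then the intervals $[x^\ast(p_{\min}),x^\ast(p_{\max})]$ and $[x^\bullet(p_{\min}),x^\bullet(p_{\max})]$ are compact attractors for the system $\dot x=f(x,p)$ for all $p\in[p_{\min},p_{\max}]$. Furthermore, for all such $p$, both intervals contain at least one fixed point of $\dot x=f(x,p)$ such that the eigenvalues of the Jacobian at this fixed point have nonpositive real parts.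
   Context: Partial order on $\mathbb{R}^N$ (for $N=n$ and $N=m$): $x\succeq y$ iff $x-y\in\mathbb{R}^N_{\ge 0}$; $x\succ y$ iff $x\succeq y$ and $x\neq y$; $x\gg y$ iff $x-y\in\mathbb{R}^N_{>0}$. $[x,y]=\{z:x\preceq z\preceq y\}$. A set $\mathcal{A}$ is order-convex if for all $x,y\in\mathcal{A}$ the closed interval $[x,y]$ is a subset of $\mathcal{A}$. $\phi_f(t,x,p)$ denotes the solution at time $t$ of $\dot x=f(x,p)$ with initial condition $x$. The basin of attraction is $\mathcal{B}(x^\ast(p))=\{x\in\mathbb{R}^n:\lim_{t\to\infty}\phi_f(t,x,p)=x^\ast(p)\}$, and similarly for $x^\bullet(p)$. $\mathcal{D}_{f(\cdot,q)}\subset\mathbb{R}^n$ is the state-space domain on which the system with parameter $q$ is considered (so the domain is the same set $\mathcal{D}$ for all parameters); for a bistable system it is the closure of the union of the basins of its two asymptotically stable fixed points. The system is monotone on $\mathcal{D}\times\mathcal{P}$ if $\phi_f(t,x,p)\preceq\phi_f(t,y,q)$ for all $t\ge0$ and all $x\preceq y$, $p\preceq q$ ($x,y\in\mathcal{D}$, $p,q\in\mathcal{P}$); it is strongly monotone on $\mathcal{D}\times\mathcal{P}$ if it is monotone and $\phi_f(t,x,p)\ll\phi_f(t,y,q)$ for all $t>0$ whenever $x\preceq y$, $p\preceq q$ and either $x\prec y$ or $p\prec q$. A compact attractor is understood as a compact set that is forward-invariant and has a neighborhood all of whose trajectories converge to the set as $t\to\infty$. The Jacobian is $\partial f/\partial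 x$. Standing assumption: for every stable fixed point considered, the Jacobian matrix of the vector field there is diagonalizable. *)

(* Defs.v *)
From mathcomp Require Import all_boot all_order all_algebra.
From mathcomp Require Import all_classical all_reals all_analysis.
From mathcomp Require Import complex.

Set Implicit Arguments.
Unset Strict Implicit.
Unset Printing Implicit Defensive.

Import Order.TTheory GRing.Theory Num.Theory.
Import numFieldNormedType.Exports.

Local Open Scope classical_set_scope.
Local Open Scope ring_scope.

Section ComponentwiseOrder.
Context {R : realType} {N : nat}.
Implicit Types x y : 'rV[R]_N.

Definition vle x y := forall i, x 0 i <= y 0 i.
Definition vlt x y := vle x y /\ x <> y.
Definition vll x y := forall i, x 0 i < y 0 i.

Definition order_interval x y : set 'rV[R]_N := [set z | vle x z /\ vle z y].

Definition order_convex (A : set 'rV[R]_N) :=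
  forall x y, A x -> A y -> order_interval x y `<=` A.

End ComponentwiseOrder.

Section Smoothness.
Context {R : realType} {n : nat}.

(* The derivative of ['J g] is continuous when each [x |-> 'd ('J g) x v] is,
   the domain being finite-dimensional. *)
Definition twice_continuously_differentiable (g : 'rV[R]_n -> 'rV[R]_n) :=
  [/\ forall x, differentiable g x,
      forall x, differentiable (jacobian g) x &
      forall v, continuous (fun x => 'd (jacobian g) x v)].

End Smoothness.

Section Dynamics.
Context {R : realType} {n m : nat}.
Variable f : 'rV[R]_n -> 'rV[R]_m -> 'rV[R]_n.
Implicit Types (x : 'rV[R]_n) (p q : 'rV[R]_m) (t : R).

(* [u] is constrained only on [0, +oo[; continuity at [0] is one-sided. *)
Definition forward_solution x p (u : R -> 'rV[R]_n) :=
  [/\ u 0 = x,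
      {within `[0, +oo[, continuous u} &
      forall t, 0 < t -> is_derive t 1 u (f (u t) p)].

Definition forward_complete x p := exists u, forward_solution x p u.

(* For [f] of class C1 in the state, the solution is unique, so the choice made
   by [xget] is immaterial. The value is meaningful only if [0 <= t] and
   [forward_complete x p]; otherwise it is junk. *)
Definition phi t x p : 'rV[R]_n :=
  xget (fun=> x) [set u | forward_solution x p u] t.

Definition basin (x0 : 'rV[R]_n) p : set 'rV[R]_n :=
  [set x | forward_complete x p /\ phi t x p @[t --> +oo] --> x0].

Definition fixed_point x p := f x p = 0.

Definition lyapunov_stable x0 p :=
  forall e : R, 0 < e ->
  \forall x \near x0, forward_complete x p /\
    forall t, 0 <= t -> ball x0 e (phi t x p).

Definition asymptotically_stable x0 p :=
  [/\ fixed_point x0 p, lyapunov_stable x0 p & nbhs x0 (basin x0 p)].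

Definition forward_invariant (A : set 'rV[R]_n) p :=
  forall x, A x ->
  forward_complete x p /\ forall t, 0 <= t -> A (phi t x p).

Definition converges_to_set x p (A : set 'rV[R]_n) :=
  forward_complete x p /\
  forall e : R, 0 < e ->
  \forall t \near +oo, exists2 a, A a & ball a e (phi t x p).

Definition compact_attractor (A : set 'rV[R]_n) p :=
  [/\ compact A,
      forward_invariant A p &
      exists U : set 'rV[R]_n, [/\ open U, A `<=` U &
        forall x, U x -> converges_to_set x p A]].

Definition monotone_on (D : set 'rV[R]_n) (P : set 'rV[R]_m) :=
  forall x y p q, D x -> D y -> P p -> P q -> vle x y -> vle p q ->
  forall t, 0 <= t -> vle (phi t x p) (phi t y q).

Definition strongly_monotone_on (D : set 'rV[R]_n) (P : set 'rV[R]_m) :=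
  monotone_on D P /\
  forall x y p q, D x -> D y -> P p -> P q -> vle x y -> vle p q ->
  vlt x y \/ vlt p q ->
  forall t, 0 < t -> vll (phi t x p) (phi t y q).

(* [jacobian] acts on row vectors, so it is the transpose of the usual matrix;
   eigenvalues and diagonalizability are unaffected. It is viewed over the
   complex numbers [R[i]]. *)
Definition complex_jacobian x p : 'M[R[i]]_n :=
  map_mx (real_complex R) (jacobian (fun z => f z p) x).

Definition diagonalizable_jacobian x p := diagonalizable (complex_jacobian x p).

Definition nonpositive_spectrum x p :=
  forall l : R[i], eigenvalue (complex_jacobian x p) l -> complex.Re l <= 0.

End Dynamics.

(* Main.v *)
Require Import Defs.
From mathcomp Require Import all_boot all_order all_algebra.
From mathcomp Require Import all_classical all_reals all_analysis.
From mathcomp Require Import complex.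
From mathcomp Require Import ring lra.

Import Order.TTheory GRing.Theory Num.Theory.
Import numFieldNormedType.Exports.

Local Open Scope classical_set_scope.
Local Open Scope ring_scope.

(** Write q1 = pmin, q2 = pmax. Two equilibria a of q1 and b of q2, each in the
    basin of the other, satisfy a <= b, and monotonicity in the state and in the
    parameter traps every p-trajectory of [a, b] in [a, b]. Basins are open
    (Picard-Lindelof and Gronwall), hence order-convex, so the intersection of
    the two basins is a neighbourhood of [a, b]; there phi(t, x, p) is squeezed
    between phi(t, x, q1) -> a and phi(t, x, q2) -> b. For a = xs(q1) and
    b = xs(q2) the mutual inclusion in the basins is a hypothesis. For xb it
    follows from xb(q1) not being below xs(q2): a point above xb(q1) cannot
    converge to xs(q2), and strong monotonicity moves xb(q1), and xb(q2), off
    the basin boundaries.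

    The fixed point is the limit l of the nondecreasing trajectory phi(t, a, p);
    it attracts a neighbourhood of itself in the cone below it. If the Jacobian J
    at l, whose off-diagonal entries are nonnegative by monotonicity, had an
    eigenvalue of real part r > 0, the moduli of the entries of an eigenvector
    would give w >= 0 with w J >= r w. For small h > 0 the flow then moves
    z = l - h w downwards in every coordinate at some time t > 0, hence by
    monotonicity phi(k t, z) <= z for all k, so z is not attracted by l. *)

(** * Calculus in row vector spaces *)

Section RowVectors.
Context {R : realType} {n : nat}.
Implicit Types x y v : 'rV[R]_n.

Lemma coord_le_norm x i : `|x 0 i| <= `|x|.
Proof. by rewrite [leRHS]/Num.norm/= mx_normrE; exact: (le_bigmax _ _ (0, i)). Qed.

Lemma rV_norm_le x e : 0 <= e -> (forall i, `|x 0 i| <= e) -> `|x| <= e.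
Proof.
move=> e0 xe; rewrite [leLHS]/Num.norm/= mx_normrE; apply: bigmax_le => // -[j i] _.
by rewrite ord1.
Qed.

Lemma rV_norm_lt x e : 0 < e -> (forall i, `|x 0 i| < e) -> `|x| < e.
Proof.
move=> e0 xe; rewrite [ltLHS]/Num.norm/= mx_normrE.
apply/bigmax_ltP; split => // -[j i] _.
by rewrite ord1.
Qed.

Lemma cvg_rVP {T : Type} (F : set_system T) {FF : Filter F} (u : T -> 'rV[R]_n) x :
  u t @[t --> F] --> x <-> forall i, u t 0 i @[t --> F] --> x 0 i.
Proof.
split=> [ux i|ux].
  apply/cvgrPdist_lt => e e0; move/cvgrPdist_lt: ux => /(_ e e0).
  apply: filterS => t; apply: le_lt_trans.
  by have := coord_le_norm (x - u t) i; rewrite !mxE.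
apply/cvgrPdist_lt => e e0.
have : \forall t \near F, forall i, `|x 0 i - u t 0 i| < e.
  by apply: filter_forall => i; move/cvgrPdist_lt: (ux i); exact.
by apply: filterS => t h; apply: rV_norm_lt => // i; rewrite !mxE.
Qed.

Lemma is_derive_rVP (u : R -> 'rV[R]_n) (t : R) v :
  is_derive t 1 u v <-> forall i, is_derive t 1 (fun s => u s 0 i) (v 0 i).
Proof.
split=> [[du duv] i|du].
  have di := (derivable_mxP u t 1).1 du 0 i.
  by apply: DeriveDef => //; rewrite -duv derive_mx// mxE.
have ud : derivable u t 1.
  by apply/derivable_mxP => j i; rewrite ord1; apply: ex_derive.
apply: DeriveDef => //; rewrite derive_mx//; apply/rowP => i; rewrite mxE.
exact: derive_val.
Qed.

Lemma is_derive_shift_rV (u : R -> 'rV[R]_n) (s t : R) v :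
  is_derive (t + s) 1 u v -> is_derive t 1 (fun r : R => u (r + s)) v.
Proof.
move=> du; apply/is_derive_rVP => i; have /is_derive_rVP/(_ i) dui := du.
have ds : is_derive t 1 (fun r : R => r + s) (1 : R).
  by apply: is_derive_eq (is_deriveD (is_derive_id t 1) (is_derive_cst s t 1)) _;
    rewrite addr0.
have := @is_derive1_comp R (fun r => u r 0 i) (fun r => r + s) t _ _ dui ds.
by rewrite mulr1.
Qed.

Lemma within_continuous_coord (A : set R) (u : R -> 'rV[R]_n) i :
  {within A, continuous u} -> {within A, continuous (fun t => u t 0 i)}.
Proof.
move=> uc x; have := uc x => /cvg_rVP; exact.
Qed.

End RowVectors.

Section RealCalculus.
Context {R : realType}.

Lemma le_of_deriv_le0 (E dE : R -> R) (a b : R) : a <= b ->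
  {within `[a, b], continuous E} ->
  (forall t, a < t -> t < b -> is_derive t 1 E (dE t)) ->
  (forall t, a < t -> t < b -> dE t <= 0) -> E b <= E a.
Proof.
rewrite le_eqVlt => /predU1P[->//|ab] Ec dEE dE0.
have [|c] := MVT (f := E) (df := dE) ab _ Ec.
  by move=> t; rewrite in_itv/= => /andP[? ?]; exact: dEE.
rewrite in_itv/= => /andP[ac cb] h; rewrite -subr_le0 h.
by rewrite mulr_le0_ge0 ?dE0// subr_ge0 ltW.
Qed.

Lemma antiderivative (h : R -> R) : continuous h ->
  exists H : R -> R, forall t : R, 0 <= t -> is_derive t 1 H (h t).
Proof.
move=> hc.
(* Starting the integral at [-1] makes [0] an interior point, so the two-sided derivative exists
   there too. *)
pose H x := (\int[@lebesgue_measure R]_(t in `[(-1 : R), x]) (h t))%R.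
exists H => t t0.
have itg : (@lebesgue_measure R).-integrable `[(-1 : R), t + 1] (EFin \o h).
  apply: continuous_compact_integrable; first exact: segment_compact.
  exact: continuous_subspaceT.
have t1 : t < t + 1 by lra.
have [|//|dH H'] := continuous_FTC1_closed t1 itg (x := t).
- by lra.
- exact: hc.
apply: DeriveDef; first exact: dH.
by rewrite -derive1E H'.
Qed.

End RealCalculus.

(** * Comparison of curves through their derivatives *)

Section Comparison.
Context {R : realType} {n : nat}.
Implicit Types (a b da db u v : R -> 'rV[R]_n).

Lemma is_derive_expRM (c t : R) :
  is_derive t 1 (fun s => expR (c * s)) (c * expR (c * t)).
Proof.
have h : is_derive t 1 (fun s : R => c * s) c.
  by apply: is_derive_eq (is_deriveZ (f := id) c _) _; rewrite /GRing.scale/= mulr1.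
apply: is_derive_eq (is_derive1_comp (f := expR) (g := fun s : R => c * s) _ h) _.
by rewrite mulrC.
Qed.

Lemma continuous_expRM (c : R) : continuous (fun s : R => expR (c * s)).
Proof.
move=> s; apply: differentiable_continuous; apply/derivable1_diffP.
by have := is_derive_expRM c s => -[].
Qed.

(** The bound on the derivatives is itself the derivative of [K * expR (c * t)]; hence each
    coordinate of [a - b], minus this function, is nonincreasing from the value [- K]. This
    integrates weighted bounds in the Picard iteration. *)
Lemma le_expR_of_deriv_le a b da db (K c T : R) : 0 <= K -> 0 <= T ->
  {within `[0, T], continuous a} -> {within `[0, T], continuous b} ->
  a 0 = b 0 ->
  (forall t, 0 < t -> t < T -> is_derive t 1 a (da t)) ->
  (forall t, 0 < t -> t < T -> is_derive t 1 b (db t)) ->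
  (forall t, 0 < t -> t < T -> `|da t - db t| <= K * c * expR (c * t)) ->
  `|a T - b T| <= K * expR (c * T).
Proof.
move=> K0 T0.
suff main i : forall a b da db,
    {within `[0, T], continuous a} -> {within `[0, T], continuous b} ->
    a 0 = b 0 ->
    (forall t, 0 < t -> t < T -> is_derive t 1 a (da t)) ->
    (forall t, 0 < t -> t < T -> is_derive t 1 b (db t)) ->
    (forall t, 0 < t -> t < T -> `|da t - db t| <= K * c * expR (c * t)) ->
    a T 0 i - b T 0 i <= K * expR (c * T).
  move=> ac bc ab0 daE dbE dab; apply: rV_norm_le => [|i].
    by rewrite mulr_ge0 ?expR_ge0.
  rewrite !mxE ler_norml lerNl opprB; apply/andP; split.
    by apply: (main i b a db da) => // t t0 tT; rewrite distrC; exact: dab.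
  exact: (main i a b da db).
move=> {}a {}b {}da {}db ac bc ab0 daE dbE dab.
pose E := (fun t => a t 0 i) - (fun t => b t 0 i) - (fun t => K * expR (c * t)).
pose dE t := (da t 0 i - db t 0 i) - K * (c * expR (c * t)).
suff : E T <= E 0.
  rewrite /E !fctE ab0 mulr0 expR0 mulr1 => h; move: h K0; lra.
apply: (@le_of_deriv_le0 _ _ dE) => //.
- apply: within_continuousB.
    by apply: within_continuousB; exact: within_continuous_coord.
  apply: continuous_subspaceT => s; apply: cvgM; first exact: cvg_cst.
  exact: continuous_expRM.
- move=> t t0 tT; apply: is_deriveB.
    by apply: is_deriveB; apply/(is_derive_rVP _ _ _).1; [exact: daE|exact: dbE].
  exact: is_deriveZ (is_derive_expRM c t).
- move=> t t0 tT; rewrite /dE subr_le0 mulrA; apply: le_trans (dab t t0 tT).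
  apply: le_trans (ler_norm _) _.
  by have := coord_le_norm (da t - db t) i; rewrite !mxE.
Qed.

(** The sup norm is not differentiable, so the estimate is made on the sum of squares [S], which
    lies between the squared norm and [n] times it. It satisfies [S' <= 2 n L S], so [S] times
    [expR (- 2 n L t)] is nonincreasing. *)
Lemma gronwall u v du dv (L T : R) : 0 <= L -> 0 <= T ->
  {within `[0, T], continuous u} -> {within `[0, T], continuous v} ->
  (forall t, 0 < t -> t < T -> is_derive t 1 u (du t)) ->
  (forall t, 0 < t -> t < T -> is_derive t 1 v (dv t)) ->
  (forall t, 0 < t -> t < T -> `|du t - dv t| <= L * `|u t - v t|) ->
  `|u T - v T| ^+ 2 <= n%:R * expR (2 * n%:R * L * T) * `|u 0 - v 0| ^+ 2.
Proof.
move=> L0 T0 uc vc duE dvE Lip.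
pose S t := \sum_(i < n) (u t 0 i - v t 0 i) ^+ 2.
have S_ge t i : (u t 0 i - v t 0 i) ^+ 2 <= S t.
  by rewrite /S (bigD1 i)//= lerDl sumr_ge0// => j _; exact: sqr_ge0.
have S_ge0 t : 0 <= S t by apply: sumr_ge0 => i _; exact: sqr_ge0.
have norm_le_S t : `|u t - v t| ^+ 2 <= S t.
  have -> : S t = Num.sqrt (S t) ^+ 2 by rewrite sqr_sqrtr.
  rewrite ler_pXn2r ?nnegrE ?sqrtr_ge0//; apply: rV_norm_le; first exact: sqrtr_ge0.
  by move=> i; rewrite !mxE -sqrtr_sqr ler_wsqrtr.
have S_le t : S t <= n%:R * `|u t - v t| ^+ 2.
  have -> : n%:R * `|u t - v t| ^+ 2 = \sum_(i < n) `|u t - v t| ^+ 2.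
    by rewrite sumr_const card_ord mulr_natl.
  apply: ler_sum => i _; rewrite -real_normK ?num_real// ler_pXn2r ?nnegrE//.
  by have := coord_le_norm (u t - v t) i; rewrite !mxE.
pose c := 2 * n%:R * L.
pose h i (t : R) := u t 0 i - v t 0 i.
pose dS t := \sum_(i < n) (2 * (u t 0 i - v t 0 i) * (du t 0 i - dv t 0 i)).
have dSE t : 0 < t -> t < T -> is_derive t 1 S (dS t).
  move=> t0 tT.
  have -> : S = \sum_(i < n) (h i ^+ 2).
    by apply/funext => s; rewrite fct_sumE; apply: eq_bigr => i _.
  have dh i : is_derive t 1 (h i) (du t 0 i - dv t 0 i).
    by apply: is_deriveB; apply/(is_derive_rVP _ _ _).1; [exact: duE|exact: dvE].
  exact: is_derive_sum.
have dS_le t : 0 < t -> t < T -> dS t <= c * S t.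
  move=> t0 tT; apply: le_trans (_ : c * `|u t - v t| ^+ 2 <= _); last first.
    by rewrite ler_wpM2l// /c !mulr_ge0.
  have -> : c * `|u t - v t| ^+ 2 =
      \sum_(i < n) (2 * `|u t - v t| * (L * `|u t - v t|)).
    by rewrite sumr_const card_ord -mulr_natl /c; ring.
  apply: ler_sum => i _; apply: le_trans (ler_norm _) _; rewrite !normrM normr_nat.
  apply: ler_pM; rewrite ?mulr_ge0//.
    by rewrite ler_wpM2l//; have := coord_le_norm (u t - v t) i; rewrite !mxE.
  apply: le_trans (Lip t t0 tT).
  by have := coord_le_norm (du t - dv t) i; rewrite !mxE.
have Sc : {within `[0, T], continuous S}.
  move=> t; apply: cvg_big; first exact: add_continuous.
  by move=> i _; rewrite expr2; apply: cvgM; apply: cvgB;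
    apply: within_continuous_coord.
have : S T * expR (- c * T) <= S 0 * expR (- c * 0).
  apply: (@le_of_deriv_le0 _ (S * (fun t => expR (- c * t)))
    (fun t => S t *: (- c * expR (- c * t)) + expR (- c * t) *: dS t)) => //.
  - move=> t; apply: cvgM; first exact: Sc.
    by apply: continuous_subspaceT; exact: continuous_expRM.
  - move=> t t0 tT; apply: is_deriveM; [exact: dSE|exact: is_derive_expRM].
  - move=> t t0 tT; rewrite /GRing.scale/=.
    have -> : S t * (- c * expR (- c * t)) + expR (- c * t) * dS t =
      expR (- c * t) * (dS t - c * S t) by ring.
    by rewrite mulr_ge0_le0 ?expR_ge0// subr_le0 dS_le.
rewrite mulr0 expR0 mulr1 mulNr expRN ler_pdivrMr ?expR_gt0// => SS.
apply: le_trans (norm_le_S T) _; apply: le_trans SS _.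
by rewrite -/c [leRHS]mulrAC ler_wpM2r ?expR_ge0.
Qed.

End Comparison.

(** * Ordinary differential equations *)

Section Picard.
Context {R : realType} {n : nat}.

(** The intervals of centre [x k] and radius [2 * K * 2^-1 ^+ k] are nested, as the radius decreases
    by [K * 2^-1 ^+ k] at each step; the supremum of their left ends lies in all of them. *)
Lemma geometric_limit (x : nat -> R) (K : R) : 0 <= K ->
  (forall k, `|x k.+1 - x k| <= K * 2^-1 ^+ k) ->
  exists l, forall k, `|x k - l| <= 2 * K * 2^-1 ^+ k.
Proof.
move=> K0 xK; pose r k : R := 2 * K * 2^-1 ^+ k.
have r0 k : 0 <= r k by rewrite /r !mulr_ge0 ?exprn_ge0.
have rS k : r k = r k.+1 + K * 2^-1 ^+ k by rewrite /r exprS; field.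
have lo j : forall k, x j - r j <= x (j + k)%N - r (j + k)%N.
  elim=> [|k IH]; first by rewrite addn0.
  apply: le_trans IH _; rewrite addnS rS; move: (xK (j + k)%N).
  rewrite ler_norml => /andP[]; lra.
have hi j : forall k, x (j + k)%N + r (j + k)%N <= x j + r j.
  elim=> [|k IH]; first by rewrite addn0.
  apply: le_trans IH; rewrite addnS (rS (j + k)%N); move: (xK (j + k)%N).
  rewrite ler_norml => /andP[]; lra.
have lohi j k : x j - r j <= x k + r k.
  have := lo j k; have := hi k j; rewrite (addnC k j) => h1 h2.
  apply: le_trans h2 _; apply: le_trans h1.
  by have := r0 (j + k)%N; lra.
pose A := range (fun k => x k - r k).
have A0 : A !=set0 by exists (x 0%N - r 0%N), 0%N.
exists (sup A) => k; rewrite -/(r k) ler_norml; apply/andP; split.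
- have : sup A <= x k + r k by apply: ge_sup => // _ [j _ <-].
  lra.
- have : x k - r k <= sup A.
    apply: ub_le_sup; last by exists k.
    by exists (x 0%N + r 0%N) => _ [j _ <-].
  lra.
Qed.

Lemma antiderivative_rV (h : R -> 'rV[R]_n) (z : 'rV[R]_n) : continuous h ->
  exists H : R -> 'rV[R]_n,
    [/\ H 0 = z, continuous H & forall t : R, 0 < t -> is_derive t 1 H (h t)].
Proof.
move=> hc.
have /choice[H0 H0E] (i : 'I_n) : exists H : R -> R,
    forall t : R, 0 <= t -> is_derive t 1 H (h t 0 i).
  by apply: antiderivative => t; have /cvg_rVP := hc t; exact.
(* [H0 i] is controlled only at nonnegative times; the even extension makes [H] continuous on the
   whole line. *)
pose H (t : R) : 'rV[R]_n := \row_i (z 0 i + (H0 i `|t| - H0 i 0)).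
exists H; split.
- by apply/rowP => i; rewrite mxE normr0 subrr addr0.
- move=> t; apply/cvg_rVP => i.
  rewrite (_ : (fun t => H t 0 i) = (fun t => z 0 i + (H0 i `|t| - H0 i 0))); last first.
    by apply/funext => s; rewrite mxE.
  rewrite /H mxE; apply: cvgD; first exact: cvg_cst.
  apply: cvgB; last exact: cvg_cst.
  apply: (@continuous_comp _ _ _ (fun t : R => `|t|) (H0 i)).
    exact: norm_continuous.
  apply/differentiable_continuous/derivable1_diffP.
  by have [] := H0E i `|t| (normr_ge0 t).
- move=> t t0; apply/is_derive_rVP => i.
  have h1 : is_derive t 1 (cst (z 0 i) + (H0 i - cst (H0 i 0))) (h t 0 i).
    apply: is_derive_eq (is_deriveD (is_derive_cst _ _ _)
      (is_deriveB (H0E i t (ltW t0)) (is_derive_cst _ _ _))) _.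
    by rewrite add0r subr0.
  apply: near_eq_is_derive h1.
  near=> s; rewrite mxE /= !fctE ger0_norm//.
  by near: s; exact: (@cvgr_ge _ _ (nbhs t) _ id t cvg_id 0 t0).
Unshelve. all: by end_near. Qed.

(* Picard iteration, contracting by a factor [1/2] for the weighted distance
   [sup_t |u t - v t| * exp (- 2 L t)] (Bielecki), hence on the whole half-line
   at once. *)
Lemma picard (g : 'rV[R]_n -> 'rV[R]_n) (L : R) (z : 'rV[R]_n) : 0 < L ->
  (forall x y, `|g x - g y| <= L * `|x - y|) ->
  exists w : R -> 'rV[R]_n,
    [/\ w 0 = z, continuous w & forall t : R, 0 < t -> is_derive t 1 w (g (w t))].
Proof.
move=> L0 Lip.
have gc : continuous g.
  move=> x; apply/(@cvgrPdist_lt _ _ _ (nbhs x) (nbhs_filter x)) => e e0.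
  apply: (@filterS _ (nbhs x) _ (ball x (L^-1 * e))) => [y|]; last first.
    by apply: nbhsx_ballx; rewrite mulr_gt0 ?invr_gt0.
  rewrite mx_norm_ball /ball_ /= => xy.
  by apply: le_lt_trans (Lip x y) _; rewrite -ltr_pdivlMl.
(* Choice requires an operator on all curves, so nothing is asked of [Pv] when [v] is
   discontinuous. *)
pose good (v Pv : R -> 'rV[R]_n) := continuous v ->
  [/\ Pv 0 = z, continuous Pv & forall t : R, 0 < t -> is_derive t 1 Pv (g (v t))].
have /choice[Phi PhiE] (v : R -> 'rV[R]_n) : exists Pv, good v Pv.
  have [vc|nvc] := pselect (continuous v); last by exists v => /nvc.
  have [|Pv [Pv0 Pvc PvE]] := @antiderivative_rV (g \o v) z.
    by move=> t; apply: continuous_comp; [exact: vc|exact: gc].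
  by exists Pv.
pose v k := iter k Phi (cst z).
have vc k : continuous (v k).
  by elim: k => [|k /PhiE[]//] t; exact: cvg_cst.
have [v0 vE] : (forall k, v k 0 = z) /\
    forall k (t : R), 0 < t -> is_derive t 1 (v k.+1) (g (v k t)).
  split=> [[|k]//|k]; by have [] := PhiE _ (vc k).
(* With [c] twice the Lipschitz constant, integrating [L * expR (c * t)] gains the factor [1/2];
   [K * c] is the norm of [g z], the constant velocity of the first iterate. *)
pose c := 2 * L; pose K := `|g z| / c.
have c0 : 0 < c by rewrite mulr_gt0.
have K0 : 0 <= K by rewrite divr_ge0// ltW.
have vS k (t : R) : 0 <= t -> `|v k.+1 t - v k t| <= K * 2^-1 ^+ k * expR (c * t).
  elim: k t => [|k IH] t t0.
    rewrite expr0 mulr1.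
    apply: (@le_expR_of_deriv_le _ _ _ _ (cst (g z)) (cst 0)) => //;
      rewrite ?v0//; try exact: continuous_subspaceT.
    - by move=> s s0 _; exact: (vE 0%N).
    - move=> s s0 _; rewrite subr0 /K divfK ?gt_eqF// ler_peMr//.
      by rewrite -expR0 ler_expR mulr_ge0// ltW.
  apply: (@le_expR_of_deriv_le _ _ _ _ (g \o v k.+1) (g \o v k)) => //;
      rewrite ?v0//; try exact: continuous_subspaceT.
  - by rewrite mulr_ge0// exprn_ge0.
  - by move=> s s0 _; exact: vE.
  - by move=> s s0 _; exact: vE.
  - move=> s s0 _; apply: le_trans (Lip _ _) _.
    apply: le_trans (ler_wpM2l (ltW L0) (IH s (ltW s0))) _.
    by rewrite le_eqVlt; apply/orP; left; apply/eqP; rewrite /c exprS; field.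
clearbody K.
have /choice[w' w'E] (t : R) : exists w : 'rV[R]_n, forall k, 0 <= t ->
    `|v k t - w| <= 2 * (K * expR (c * t)) * 2^-1 ^+ k.
  have [t0|_] := boolP (0 <= t); last by exists 0.
  have /choice[w wE] (i : 'I_n) : exists l, forall k,
      `|v k t 0 i - l| <= 2 * (K * expR (c * t)) * 2^-1 ^+ k.
    apply: geometric_limit => [|k]; first by rewrite mulr_ge0 ?expR_ge0.
    rewrite mulrAC; apply: le_trans (vS k t t0).
    by have := coord_le_norm (v k.+1 t - v k t) i; rewrite !mxE.
  exists (\row_i w i) => k _; apply: rV_norm_le => [|i].
    by rewrite !mulr_ge0 ?expR_ge0 ?exprn_ge0 ?invr_ge0.
  by rewrite !mxE.
pose w (t : R) := w' `|t|.
have wE k (t : R) : 0 <= t -> `|v k t - w t| <= 2 * (K * expR (c * t)) * 2^-1 ^+ k.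
  by move=> t0; rewrite /w ger0_norm//; exact: w'E.
have small (M e : R) : 0 <= M -> 0 < e -> exists k, M * 2^-1 ^+ k < e.
  move=> M0 e0.
  have : M * 2^-1 ^+ k @[k --> \oo] --> M * 0.
    apply: cvgM; first exact: cvg_cst.
    apply: cvg_expr; rewrite ger0_norm ?invr_ge0//; lra.
  rewrite mulr0 => /cvgr_lt/(_ e e0)[k _ kE]; exists k; exact: kE (leqnn k).
have wc : continuous w.
  move=> t; apply/cvgrPdist_lt => e e0.
  pose M := 2 * (K * expR (c * (`|t| + 1))).
  have M0 : 0 <= M by rewrite !mulr_ge0 ?expR_ge0.
  have [k kM] := small M (e / 3) M0 ltac:(by rewrite divr_gt0).
  have wM (s : R) : `|s| <= `|t| + 1 -> `|v k `|s| - w s| < e / 3.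
    move=> st; apply: le_lt_trans kM.
    have := wE k `|s| (normr_ge0 s); rewrite /w normr_id => h.
    apply: le_trans h _; rewrite ler_wpM2r ?exprn_ge0// /M.
    by rewrite ler_wpM2l// ler_wpM2l// ler_expR ler_wpM2l// ltW.
  have vnc : {for t, continuous (v k \o (fun s : R => `|s|))}.
    by apply: continuous_comp; [exact: norm_continuous|exact: vc].
  near=> s.
  have h1 := wM t ltac:(by lra).
  have h2 : `|v k `|s| - w s| < e / 3.
    apply: wM; near: s.
    have : `|s| @[s --> t] --> `|t| by exact: norm_continuous.
    by move=> /cvgr_le; apply; lra.
  have h3 : `|v k `|t| - v k `|s| | < e / 3.
    near: s; move/cvgrPdist_lt : vnc; apply; by rewrite divr_gt0.
  have -> : w t - w s = - (v k `|t| - w t) + (v k `|t| - v k `|s|) +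
      (v k `|s| - w s).
    by rewrite opprB !addrA !subrK.
  apply: le_lt_trans (ler_normD _ _) _.
  have h4 := ler_normD (- (v k `|t| - w t)) (v k `|t| - v k `|s|).
  rewrite normrN in h4; lra.
have [u0 uc uE] := PhiE _ wc.
(* The image [v k.+1] of [v k] tends both to [w] and to the image of [w], so these two agree on the
   half-line. *)
have uw (t : R) : 0 <= t -> Phi w t = w t.
  move=> t0; apply/eqP; rewrite -subr_eq0 -normr_le0; apply/ler_addgt0Pl => e e0.
  rewrite addr0.
  pose M := 2 * (K * expR (c * t)).
  have M0 : 0 <= M by rewrite !mulr_ge0 ?expR_ge0.
  have [k kM] := small M (e / 2) M0 ltac:(by rewrite divr_gt0).
  have h1 : `|v k.+1 t - w t| <= e / 2.
    apply: le_trans (wE _ _ t0) _; apply: le_trans (ltW kM).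
    rewrite ler_wpM2l// exprS ler_piMl ?exprn_ge0//; lra.
  have h2 : `|Phi w t - v k.+1 t| <= K * 2^-1 ^+ k * expR (c * t).
    apply: (@le_expR_of_deriv_le _ _ _ _ (g \o w) (g \o v k)).
    - by rewrite mulr_ge0// exprn_ge0.
    - exact: t0.
    - exact: continuous_subspaceT.
    - exact: continuous_subspaceT.
    - by rewrite u0 v0.
    - by move=> s s0 _; exact: uE.
    - by move=> s s0 _; exact: vE.
    - move=> s s0 _; apply: le_trans (Lip _ _) _; rewrite distrC.
      apply: le_trans (ler_wpM2l (ltW L0) (wE k s (ltW s0))) _.
      by rewrite le_eqVlt; apply/orP; left; apply/eqP; rewrite /c; ring.
  have -> : Phi w t - w t = (Phi w t - v k.+1 t) + (v k.+1 t - w t).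
    by rewrite !addrA subrK.
  apply: le_trans (ler_normD _ _) _.
  have ME : M * 2^-1 ^+ k = 2 * (K * 2^-1 ^+ k * expR (c * t)) by rewrite /M; ring.
  have q0 : 0 <= K * 2^-1 ^+ k * expR (c * t).
    by rewrite !mulr_ge0 ?expR_ge0 ?exprn_ge0 ?invr_ge0.
  lra.
exists (Phi w); split => // t t0.
by rewrite uw ?ltW//; exact: uE.
Unshelve. all: by end_near. Qed.

End Picard.

(** * Local Lipschitz bounds and truncation of fields *)

Section LocalLipschitz.
Context {R : realType} {n : nat}.
Implicit Types (x y v : 'rV[R]_n) (F : 'rV[R]_n -> 'rV[R]_n).

Lemma nbhs_rVP x (A : set 'rV[R]_n) :
  nbhs x A <-> exists2 e : R, 0 < e & forall y, `|x - y| < e -> A y.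
Proof.
split=> [/nbhs_ballP[e /= e0 eA]|[e e0 eA]].
  exists e => // y xy; apply: eA; by rewrite mx_norm_ball.
apply/nbhs_ballP; exists e => // y; rewrite mx_norm_ball; exact: eA.
Qed.

Lemma is_derive_line F y v (s : R) d : is_derive (s *: v + y) v F d ->
  is_derive s 1 (fun r : R => F (r *: v + y)) d.
Proof.
pose G (r : R) := F (r *: v + y).
have E : (fun h : R => h^-1 *: ((G \o shift s) (h *: 1) - G s)) =
    (fun h : R => h^-1 *: ((F \o shift (s *: v + y)) (h *: v) - F (s *: v + y))).
  apply/funext => h; rewrite /G /=; congr (_ *: (F _ - _)).
  by rewrite scalerDl [h%:A]mulr1 addrA.
move=> [dF DF]; apply: DeriveDef.
  by rewrite /derivable -/G E.
by rewrite /derive -/G E.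
Qed.

Definition lipschitz_on_balls F := forall M : R, exists2 L, 0 < L &
  forall x y, `|x| <= M -> `|y| <= M -> `|F x - F y| <= L * `|x - y|.

(** The Jacobian is bounded by some [B] on the compact cube of radius [M], and the mean value
    theorem along the segment from [y] to [x], applied to each coordinate, gives the constant
    [n%:R * B]; the added [1] keeps it positive in dimension [0]. *)
Lemma C2_lipschitz_on_balls F :
  twice_continuously_differentiable F -> lipschitz_on_balls F.
Proof.
move=> [dF dJ _] M.
pose K := [set v : 'rV[R]_n | forall i, `[- M, M]%classic (v ord0 i)].
have Kc : compact K.
  by apply: (@rV_compact _ _ (fun=> `[- M, M]%classic)) => _; exact: segment_compact.
have KM x : `|x| <= M -> K x.
  move=> xM i; rewrite /= in_itv/= -ler_norml.
  exact: le_trans (coord_le_norm _ _) xM.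
have Jc : continuous (jacobian F).
  by move=> x; apply: differentiable_continuous; exact: dJ.
have /compact_bounded[B0 [_ B0E]] : compact (jacobian F @` K).
  by apply: continuous_compact => //; exact: continuous_subspaceT.
pose B := `|B0| + 1.
have BE x : K x -> `|jacobian F x| <= B.
  move=> Kx; apply: (B0E B _ (jacobian F x)); last by exists x.
  by rewrite /B; have := ler_norm B0; lra.
have nB : 0 <= n%:R * B.
  by apply: mulr_ge0 => //; rewrite /B; have := normr_ge0 B0; lra.
exists (n%:R * B + 1) => [|x y xM yM]; first by lra.
apply: rV_norm_le => [|i]; first by apply: mulr_ge0 => //; lra.
pose v := x - y.
pose h (s : R) := F (s *: v + y) 0 i.
pose dh (s : R) := (v *m jacobian F (s *: v + y)) 0 i.
have hE (s : R) : is_derive s 1 h (dh s).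
  have : is_derive (s *: v + y) v F (v *m jacobian F (s *: v + y)).
    apply: DeriveDef; first exact: diff_derivable.
    exact: deriveEjacobian.
  by move=> /is_derive_line/is_derive_rVP; exact.
have hc : {within `[0, 1], continuous h}.
  apply: continuous_subspaceT => s; apply: differentiable_continuous.
  by apply/derivable1_diffP; have [] := hE s.
have [c] := MVT ltr01 (fun s _ => hE s) hc.
rewrite in_itv/= => /andP[c0 c1].
rewrite /h scale1r scale0r add0r /v subrK subr0 mulr1 => FE.
rewrite !mxE FE /dh mxE.
have Kc' : K (c *: v + y).
  apply: KM; rewrite (_ : _ + _ = c *: x + (1 - c) *: y); last first.
    by rewrite /v scalerBr scalerBl scale1r addrAC -addrA addrC -addrA [- _ + _]addrC.
  apply: le_trans (ler_normD _ _) _; rewrite !normrZ !ger0_norm; last 2 first.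
    by rewrite subr_ge0 ltW.
    exact: ltW.
  have h1 := ler_wpM2l (ltW c0) xM.
  have c1' : 0 <= 1 - c by rewrite subr_ge0 ltW.
  have h2 := ler_wpM2l c1' yM.
  apply: le_trans (lerD h1 h2) _; lra.
apply: le_trans (ler_norm_sum _ _ _) _.
apply: le_trans (_ : \sum_(j < n) (B * `|x - y|) <= _).
  apply: ler_sum => j _; rewrite normrM mulrC; apply: ler_pM => //.
    apply: le_trans (BE _ Kc').
    by rewrite [leRHS]/Num.norm/= mx_normrE; exact: (le_bigmax _ _ (j, i)).
  exact: coord_le_norm.
rewrite sumr_const card_ord -[leLHS]mulr_natl mulrA.
by rewrite ler_wpM2r// lerDl.
Qed.

(** For [M >= 0], the coordinatewise retraction onto the closed ball of radius [M] of the sup norm.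
    Being 1-Lipschitz, it turns a field that is Lipschitz on balls into a globally Lipschitz one, to
    which [picard] applies. *)
Definition clamp (M : R) x : 'rV[R]_n := \row_i Num.max (- M) (Num.min M (x 0 i)).

Lemma clamp_lipschitz M x y : `|clamp M x - clamp M y| <= `|x - y|.
Proof.
apply: rV_norm_le => // i; rewrite !mxE.
have h := coord_le_norm (x - y) i; rewrite !mxE in h.
apply: le_trans h.
move: (ler_norm (x 0 i - y 0 i)) (ler_norm (- (x 0 i - y 0 i))).
rewrite normrN ler_norml; move: `|_| => N h1 h2.
case: (leP M (x 0 i)) => ?; case: (leP M (y 0 i)) => ?;
  case: (leP (- M) M) => ?; case: (leP (- M) (x 0 i)) => ?;
  case: (leP (- M) (y 0 i)) => ?; apply/andP; split; lra.
Qed.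

Lemma clamp_norm M x : 0 <= M -> `|clamp M x| <= M.
Proof.
move=> M0; apply: rV_norm_le => // i; rewrite !mxE ler_norml.
by rewrite le_max lexx/= ge_max ge_min lexx/=; lra.
Qed.

Lemma clamp_id M x : `|x| <= M -> clamp M x = x.
Proof.
move=> xM; apply/rowP => i; rewrite mxE.
have := le_trans (coord_le_norm x i) xM; rewrite ler_norml => /andP[h1 h2].
by rewrite min_r// max_r.
Qed.

End LocalLipschitz.

Section HalfLine.
Context {R : realType} {n : nat}.

(** Composing with the absolute value turns one-sided continuity at [0] into ordinary continuity,
    which is easier to compose. *)
Lemma within_half_lineP (u : R -> 'rV[R]_n) :
  {within `[0, +oo[, continuous u} <-> continuous (fun t : R => u `|t|).
Proof.
split=> [/subspace_continuousP uc t B /(uc `|t|) |uc].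
  rewrite /= in_itv/= andbT normr_ge0 => /(_ isT) h.
  have h2 := @norm_continuous _ R^o t _ h.
  apply: (@filterS R (nbhs t) _ (fun s => `[0, +oo[%classic `|s| -> B (u `|s|)) _ _ h2).
  by move=> s; apply; rewrite /= in_itv/= andbT.
apply/subspace_continuousP => t; rewrite /= in_itv/= andbT => t0 B.
move=> uB; have := uc t B; rewrite ger0_norm// => /(_ uB).
rewrite !near_simpl /=; apply: filterS => s /= us.
by rewrite in_itv/= andbT => s0; rewrite -(ger0_norm s0).
Qed.

Lemma near_pinftyP (A : set R) :
  (\forall t \near +oo, A t) <-> exists2 T, 0 <= T & forall t, T < t -> A t.
Proof.
split=> [[M [_ MA]]|[T T0 TA]]; last first.
  by exists T; split => //; exact: num_real.
exists (`|M|) => // t Mt; apply: MA; exact: le_lt_trans (ler_norm _) Mt.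
Qed.

End HalfLine.

(** * Uniqueness, semigroup property and limits of trajectories *)

Section Flow.
Context {R : realType} {n m : nat}.
Variable f : 'rV[R]_n -> 'rV[R]_m -> 'rV[R]_n.
Variable p : 'rV[R]_m.
Hypothesis f_lip : lipschitz_on_balls (fun x => f x p).
Implicit Types (x y z : 'rV[R]_n) (u v : R -> 'rV[R]_n).

Lemma forward_solution_within x u (T : R) : forward_solution f x p u ->
  {within `[0, T], continuous u}.
Proof.
by case=> _ uc _; apply: continuous_subspaceW uc; apply: subset_itvl; rewrite bnd_simp.
Qed.

Lemma forward_solution_bounded x u (T : R) : forward_solution f x p u ->
  exists2 M, 0 <= M & forall t, 0 <= t -> t <= T -> `|u t| <= M.
Proof.
move=> su; have uc := forward_solution_within _ _ T su.
have /compact_bounded[B0 [_ B0E]] : compact (u @` `[0, T]).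
  by apply: (continuous_compact uc); exact: (@segment_compact R 0 T).
exists (`|B0| + 1); first by rewrite addr_ge0.
move=> t t0 tT; apply: (B0E (`|B0| + 1) _ (u t)).
  by have := ler_norm B0; lra.
by exists t => //=; rewrite in_itv/= t0.
Qed.

Lemma forward_solution_unique x u v (t : R) :
  forward_solution f x p u -> forward_solution f x p v -> 0 <= t -> u t = v t.
Proof.
move=> su sv t0.
have [M1 M10 uM] := forward_solution_bounded _ _ t su.
have [M2 M20 vM] := forward_solution_bounded _ _ t sv.
have [L L0 Lip] := f_lip (M1 + M2).
have [u0 _ uE] := su; have [v0 _ vE] := sv.
have := @gronwall R n u v (fun t => f (u t) p) (fun t => f (v t) p) L t (ltW L0) t0
  (forward_solution_within _ _ _ su) (forward_solution_within _ _ _ sv)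
  (fun s s0 _ => uE s s0) (fun s s0 _ => vE s s0).
rewrite u0 v0 subrr normr0 expr0n/= mulr0 => h.
have : `|u t - v t| ^+ 2 <= 0.
  apply: h => s s0 st; apply: Lip.
    by have := uM s (ltW s0) (ltW st); lra.
  by have := vM s (ltW s0) (ltW st); lra.
move=> h2; have : `|u t - v t| ^+ 2 == 0 by rewrite eq_le h2 exprn_ge0.
by rewrite sqrf_eq0 normr_eq0 subr_eq0 => /eqP.
Qed.

Lemma phi_forward_solution x : forward_complete f x p ->
  forward_solution f x p (fun t => phi f t x p).
Proof. by move=> [u su]; have := @xgetPex _ (fun=> x) _ (ex_intro _ u su). Qed.

Lemma phi_unique x u (t : R) : forward_solution f x p u -> 0 <= t -> phi f t x p = u t.
Proof.
move=> su t0; apply: forward_solution_unique t0; last exact: su.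
by apply: phi_forward_solution; exists u.
Qed.

Lemma phi0 x : forward_complete f x p -> phi f 0 x p = x.
Proof. by move=> /phi_forward_solution[]. Qed.

Lemma forward_solution_shift x u (s : R) : forward_solution f x p u -> 0 <= s ->
  forward_solution f (u s) p (fun t => u (t + s)).
Proof.
move=> [u0 /within_half_lineP uc uE] s0; split; first by rewrite add0r.
- apply/within_half_lineP => t.
  rewrite [X in continuous_at _ X](_ : _ = (fun r => u `|r|) \o (fun t => `|t| + s)).
    apply: continuous_comp; last exact: uc.
    by apply: cvgD; [exact: norm_continuous|exact: cvg_cst].
  by apply/funext => r /=; rewrite (@ger0_norm _ (`|r| + s))// addr_ge0.
- by move=> t t0; apply: is_derive_shift_rV; apply: uE; rewrite ltr_wpDr.
Qed.

Lemma phiD x (s t : R) : forward_complete f x p -> 0 <= s -> 0 <= t ->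
  phi f (t + s) x p = phi f t (phi f s x p) p.
Proof.
move=> /phi_forward_solution sx s0 t0.
by rewrite (phi_unique _ _ _ (forward_solution_shift _ _ _ sx s0) t0).
Qed.

Lemma fixed_point_forward_solution x : fixed_point f x p ->
  forward_solution f x p (cst x).
Proof.
move=> fx; split=> //; first by apply: continuous_subspaceT => t; exact: cvg_cst.
by move=> t t0; rewrite fx; exact: is_derive_cst.
Qed.

Lemma phi_fixed_point x (t : R) : fixed_point f x p -> 0 <= t -> phi f t x p = x.
Proof. by move=> /fixed_point_forward_solution sx /(phi_unique _ _ _ sx). Qed.

Lemma continuous_field : continuous (fun x => f x p).
Proof.
move=> x; have [L L0 Lip] := f_lip (`|x| + 1).
apply/(@cvgrPdist_lt _ _ _ (nbhs x) (nbhs_filter x)) => e e0.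
apply/nbhs_rVP; exists (Num.min 1 (L^-1 * e)) => [|y].
  by rewrite lt_min ltr01 mulr_gt0// invr_gt0.
rewrite lt_min => /andP[xy1 xye].
apply: le_lt_trans (Lip x y _ _) _.
- by lra.
- have -> : y = x - (x - y) by rewrite subKr.
  by apply: le_trans (ler_normB _ _) _; lra.
- by rewrite -ltr_pdivlMl.
Qed.

(** By the mean value theorem on [[T + 1, T + 2]], the increment of a coordinate over unit time
    equals that coordinate of the field at an intermediate time; the former tends to [0], the latter
    to its value at [l]. *)
Lemma limit_fixed_point x l : forward_complete f x p ->
  phi f t x p @[t --> +oo] --> l -> fixed_point f l p.
Proof.
move=> cx xl; rewrite /fixed_point; apply/rowP => i; rewrite mxE.
have fl : f (phi f t x p) p @[t --> +oo] --> f l p.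
  exact: (cvg_comp (fun t => phi f t x p) (fun x => f x p) xl (continuous_field l)).
apply/eqP; rewrite -normr_le0; apply/ler_addgt0Pl => e e0; rewrite addr0.
have e4 : 0 < e / 4 by rewrite divr_gt0.
have /near_pinftyP[T T0 TE] : \forall t \near +oo,
    `|l - phi f t x p| < e / 4 /\ `|f l p - f (phi f t x p) p| < e / 4.
  have h1 : \forall t \near +oo, `|l - phi f t x p| < e / 4.
    by move/cvgrPdist_lt: xl; exact.
  have h2 : \forall t \near +oo, `|f l p - f (phi f t x p) p| < e / 4.
    by move/cvgrPdist_lt: fl; exact.
  exact: filterI.
have [_ uc uE] := phi_forward_solution _ cx.
have duE (t : R) : t \in `](T + 1), (T + 2)[ ->
    is_derive t 1 (fun t => phi f t x p 0 i) (f (phi f t x p) p 0 i).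
  rewrite in_itv/= => /andP[t1 t2].
  by apply/(is_derive_rVP (fun t => phi f t x p) _ _).1/uE; lra.
have uci : {within `[T + 1, T + 2], continuous (fun t => phi f t x p 0 i)}.
  apply: (@within_continuous_coord R n _ (fun t => phi f t x p)).
  apply: continuous_subspaceW uc.
  by apply: subset_itv; rewrite bnd_simp//; lra.
have T12 : T + 1 < T + 2 by lra.
have [c] := MVT T12 duE uci.
rewrite in_itv/= => /andP[c1 c2] cE.
have [_ /(le_lt_trans (coord_le_norm _ i)) hc] := TE c ltac:(lra).
have [/(le_lt_trans (coord_le_norm _ i)) h1 _] := TE (T + 1) ltac:(lra).
have [/(le_lt_trans (coord_le_norm _ i)) h2 _] := TE (T + 2) ltac:(lra).
move: hc h1 h2 cE; rewrite !mxE !ltr_norml => /andP[? ?] /andP[? ?] /andP[? ?] ?.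
by rewrite ler_norml; apply/andP; split; lra.
Qed.

End Flow.

Section BasinOpen.
Context {R : realType} {n m : nat}.
Variable f : 'rV[R]_n -> 'rV[R]_m -> 'rV[R]_n.
Variable p : 'rV[R]_m.
Hypothesis f_lip : lipschitz_on_balls (fun x => f x p).

(* The trajectory issued from a nearby point is obtained by solving the field
   truncated to a large ball: it follows the given trajectory until both are
   close to [x0], and Lyapunov stability keeps it in the ball afterwards. *)
Lemma open_basin x0 : asymptotically_stable f x0 p -> open (basin f x0 p).
Proof.
move=> [_ x0stable x0nbhs]; rewrite openE => x [cx xx0].
(* Trajectories starting within [d] of [x0] converge to [x0] and, by stability with radius [1], keep
   a norm of at most [|x0| + 1]. *)
have [d d0 dE] : exists2 d : R, 0 < d & forall y, `|x0 - y| < d ->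
    [/\ basin f x0 p y, forward_complete f y p &
       forall t : R, 0 <= t -> `|phi f t y p| <= `|x0| + 1].
  have /nbhs_rVP[d1 d10 d1E] := x0stable 1 ltr01.
  have /nbhs_rVP[d2 d20 d2E] := x0nbhs.
  exists (Num.min d1 d2) => [|y]; first by rewrite lt_min d10.
  rewrite lt_min => /andP[/d1E[cy yt] /d2E By]; split => // t t0.
  have := yt t t0; rewrite mx_norm_ball /ball_ /= => h.
  have -> : phi f t y p = x0 - (x0 - phi f t y p) by rewrite subKr.
  by apply: le_trans (ler_normB _ _) _; rewrite lerD2l ltW.
pose u := fun t : R => phi f t x p.
have su : forward_solution f x p u by exact: phi_forward_solution.
have [u0 uc uE] := su.
have [T T0 uT] : exists2 T : R, 0 <= T & `|x0 - u T| < d / 2.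
  have : \forall t \near +oo, `|x0 - u t| < d / 2.
    by move/cvgrPdist_lt: xx0; apply; rewrite divr_gt0.
  move=> /near_pinftyP[T T0 TE]; exists (T + 1); first by lra.
  by apply: TE; lra.
have [M0 M00 uM] := forward_solution_bounded f p x u T su.
(* [M] bounds the trajectory of [x] up to time [T] with a margin of at least [1], and also the
   trajectories starting near [x0], so the truncation at [M] is never felt. *)
pose M := M0 + `|x0| + 1.
have x0_ge0 : 0 <= `|x0| by [].
have M_ge0 : 0 <= M by rewrite /M; lra.
have [L L0 Lip] := f_lip M.
pose g z := f (clamp M z) p.
have gLip y z : `|g y - g z| <= L * `|y - z|.
  apply: le_trans (Lip _ _ _ _) _; rewrite ?clamp_norm//.
  by rewrite ler_wpM2l ?clamp_lipschitz// ltW.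
have gE z : `|z| <= M -> g z = f z p by move=> zM; rewrite /g clamp_id.
(* The deviation allowed up to time [T]: [1] keeps the new curve within norm [M], and [d / 2] brings
   it within [d] of [x0] at time [T]. *)
pose e := Num.min 1 (d / 2).
have e0 : 0 < e by rewrite lt_min ltr01 divr_gt0.
(* As [C >= 1], an initial distance below [e / C] gives a squared distance below
   [C * (e / C) ^+ 2 <= e ^+ 2]. *)
pose C := n%:R * expR (2 * n%:R * L * T) + 1.
have C1 : 1 <= C by rewrite /C lerDr mulr_ge0// expR_ge0.
have C0 : 0 < C by lra.
rewrite /interior; apply/nbhs_rVP; exists (e / C) => [|z xz]; first by rewrite divr_gt0.
have [w [w0 wc wE]] := picard g L z L0 gLip.
have wc' (T' : R) : {within `[0, T'], continuous w} by exact: continuous_subspaceT.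
have uw t : 0 <= t -> t <= T -> `|u t - w t| < e.
  move=> t0 tT.
  have h : `|u t - w t| ^+ 2 <= n%:R * expR (2 * n%:R * L * t) * `|u 0 - w 0| ^+ 2.
    apply: (@gronwall _ _ u w (g \o u) (g \o w)) => //.
    - exact: ltW.
    - exact: forward_solution_within su.
    - move=> s s0 st; rewrite /= gE; first exact: uE.
      have := uM s (ltW s0) ltac:(lra); rewrite /M; lra.
    - by move=> s s0 _; exact: wE.
    - by move=> s s0 _; exact: gLip.
  suff : `|u t - w t| ^+ 2 < e ^+ 2 by rewrite ltr_pXn2r ?nnegrE// ltW.
  apply: le_lt_trans h _; rewrite u0 w0.
  apply: le_lt_trans (_ : C * `|x - z| ^+ 2 < _).
    rewrite ler_wpM2r ?exprn_ge0// /C.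
    apply: le_trans (_ : _ <= n%:R * expR (2 * n%:R * L * T)) _.
      by rewrite ler_wpM2l// ler_expR ler_wpM2l// !mulr_ge0// ltW.
    by rewrite lerDl.
  apply: lt_le_trans (_ : C * (e / C) ^+ 2 <= _).
    by rewrite ltr_pM2l// ltr_pXn2r ?nnegrE// ltW// divr_gt0.
  rewrite expr_div_n mulrCA ler_piMr ?exprn_ge0 ?(ltW e0)//.
  by rewrite expr2 invfM mulrA divff ?gt_eqF// mul1r invf_le1.
have wT : `|x0 - w T| < d.
  have h := uw T T0 (lexx _).
  have h2 : e <= d / 2 by rewrite /e ge_min lexx orbT.
  have -> : x0 - w T = (x0 - u T) + (u T - w T) by rewrite addrA subrK.
  by apply: le_lt_trans (ler_normD _ _) _; lra.
have [[_ yx0] cy yM] := dE _ wT.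
have sy := phi_forward_solution f p _ cy.
have [y0 yc yE] := sy.
have yw t : 0 <= t -> phi f t (w T) p = w (t + T).
  move=> t0.
  have h : `|phi f t (w T) p - w (t + T)| ^+ 2 <= n%:R * expR (2 * n%:R * L * t) *
      `|phi f 0 (w T) p - w (0 + T)| ^+ 2.
    apply: (@gronwall _ _ (fun t => phi f t (w T) p) (fun t => w (t + T))
       (fun t => g (phi f t (w T) p)) (fun t => g (w (t + T)))).
    - exact: ltW.
    - exact: t0.
    - exact: (forward_solution_within f p _ _ t sy).
    - apply: continuous_subspaceT => s.
      by apply: continuous_comp; [apply: cvgD; [exact: cvg_id|exact: cvg_cst]|exact: wc].
    - move=> s s0 _; rewrite gE; first exact: yE.
      apply: le_trans (yM _ (ltW s0)) _; rewrite /M; lra.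
    - move=> s s0 _; apply: is_derive_shift_rV; apply: wE; lra.
    - by move=> s _ _; exact: gLip.
  rewrite y0 add0r subrr normr0 expr0n/= mulr0 in h.
  have : `|phi f t (w T) p - w (t + T)| ^+ 2 == 0 by rewrite eq_le h exprn_ge0.
  by rewrite sqrf_eq0 normr_eq0 subr_eq0 => /eqP.
have wM t : 0 <= t -> `|w t| <= M.
  move=> t0; have [tT|tT] := leP t T.
    have -> : w t = u t - (u t - w t) by rewrite subKr.
    apply: le_trans (ler_normB _ _) _.
    have h1 := uM t t0 tT; have h2 := uw t t0 tT.
    have h3 : e <= 1 by rewrite /e ge_min lexx.
    rewrite /M; lra.
  have -> : w t = phi f (t - T) (w T) p by rewrite yw ?subrK//; lra.
  apply: le_trans (yM _ _) _; first by lra.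
  by rewrite /M; lra.
have sw : forward_solution f z p w.
  split => //; first exact: continuous_subspaceT.
  by move=> t t0; rewrite -gE; [exact: wE|rewrite wM// ltW].
split; first by exists w.
apply/cvgrPdist_lt => r r0; apply/near_pinftyP.
have /near_pinftyP[T1 T10 T1E] : \forall t \near +oo, `|x0 - phi f t (w T) p| < r.
  by move/cvgrPdist_lt: yx0; exact.
exists (T1 + T) => [|t tT1]; first by rewrite addr_ge0.
rewrite (phi_unique f p f_lip z w) //; last by lra.
have := T1E (t - T) ltac:(lra); rewrite yw ?subrK//; lra.
Qed.

End BasinOpen.

(** * Monotone flows *)

Section Order.
Context {R : realType} {n : nat}.
Implicit Types (x y z l : 'rV[R]_n) (u v w : R -> 'rV[R]_n).

Lemma vle_refl x : vle x x. Proof. by move=> i. Qed.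

Lemma vle_trans y x z : vle x y -> vle y z -> vle x z.
Proof. by move=> xy yz i; exact: le_trans (xy i) (yz i). Qed.

Lemma vle_anti x y : vle x y -> vle y x -> x = y.
Proof. by move=> xy yx; apply/rowP => i; apply/le_anti; rewrite xy yx. Qed.

Lemma vllW x y : vll x y -> vle x y.
Proof. by move=> xy i; exact: ltW. Qed.

Lemma vll_le_trans y x z : vll x y -> vle y z -> vll x z.
Proof. by move=> xy yz i; exact: lt_le_trans (xy i) (yz i). Qed.

Lemma near_vll_left x y : vll x y -> \forall z \near y, vll x z.
Proof.
move=> xy.
apply: (@filter_forall _ _ (fun i z => x 0 i < z 0 i) (nbhs y) (nbhs_filter y)) => i.
exact: (cvgr_gt _ (@coord_continuous _ _ _ 0 i y) _ (xy i)).
Qed.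

Lemma near_vll_right x y : vll x y -> \forall z \near x, vll z y.
Proof.
move=> xy.
apply: (@filter_forall _ _ (fun i z => z 0 i < y 0 i) (nbhs x) (nbhs_filter x)) => i.
exact: (cvgr_lt _ (@coord_continuous _ _ _ 0 i x) _ (xy i)).
Qed.

Lemma near_ray x (v : 'rV[R]_n) (A : set 'rV[R]_n) : nbhs x A ->
  \forall h \near (0 : R)^'+, A (x + h *: v).
Proof.
move=> xA; have hc : (x + h *: v) @[h --> (0 : R)] --> x + 0 *: v.
  by apply: cvgD; [exact: cvg_cst|exact: cvgZr_tmp].
rewrite scale0r addr0 in hc; rewrite near_withinE.
apply: (@filterS R (nbhs (0 : R)) _ (fun h => A (x + h *: v))) => [h hA _//|].
exact: hc.
Qed.

Lemma vle_cvg u v x y : (forall t : R, 0 <= t -> vle (u t) (v t)) ->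
  u t @[t --> +oo] --> x -> v t @[t --> +oo] --> y -> vle x y.
Proof.
move=> uv /cvg_rVP ux /cvg_rVP vy i; apply: (ler_cvg_to (ux i) (vy i)).
by apply/near_pinftyP; exists 0 => // t /ltW/uv; exact.
Qed.

Lemma squeeze_vle u v w l :
  (forall t : R, 0 <= t -> vle (u t) (v t)) -> (forall t : R, 0 <= t -> vle (v t) (w t)) ->
  u t @[t --> +oo] --> l -> w t @[t --> +oo] --> l -> v t @[t --> +oo] --> l.
Proof.
move=> uv vw /cvg_rVP ul /cvg_rVP wl; apply/cvg_rVP => i.
apply: squeeze_cvgr (ul i) (wl i).
by apply/near_pinftyP; exists 0 => // t /ltW t0; rewrite uv ?vw.
Qed.

Lemma nondecreasing_vle_cvg u y :
  (forall s t : R, 0 <= s -> 0 <= t -> vle (u s) (u (s + t))) ->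
  (forall t : R, 0 <= t -> vle (u t) y) ->
  exists2 l, u t @[t --> +oo] --> l & forall t : R, 0 <= t -> vle (u t) l.
Proof.
move=> und uy.
(* Freezing the curve at [u 0] for negative times makes it monotone on the whole line. *)
pose h i (t : R) := u (Num.max 0 t) 0 i.
have m0 (t : R) : 0 <= Num.max 0 t by rewrite le_max lexx.
have hnd i : nondecreasing_fun (h i).
  move=> s t st; rewrite /h.
  have := und (Num.max 0 s) (Num.max 0 t - Num.max 0 s) (m0 s).
  rewrite addrCA subrr addr0 => /(_ _ i); apply.
  by rewrite subr_ge0 ge_max le_max lexx/= le_max st orbT.
have hub i : has_ubound (range (h i)).
  by exists (y 0 i) => _ [t _ <-]; exact: uy.
have hl i := nondecreasing_cvgr (hnd i) (hub i).
exists (\row_i sup (range (h i))) => [|t t0 i].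
  apply/cvg_rVP => i; rewrite mxE; apply: cvg_trans (hl i).
  apply: near_eq_cvg; apply/near_pinftyP; exists 0 => // t /ltW t0.
  by rewrite /h max_r.
rewrite mxE; apply: ub_le_sup => //; exists t => //.
by rewrite /h max_r.
Qed.

End Order.

(** * Basins and trajectories of a monotone flow *)

Section MonotoneFlow.
Context {R : realType} {n m : nat}.
Variable f : 'rV[R]_n -> 'rV[R]_m -> 'rV[R]_n.
Variables (P : set 'rV[R]_m) (D : set 'rV[R]_n).
Hypothesis f_lip : forall p, P p -> lipschitz_on_balls (fun x => f x p).
Hypothesis D_invariant : forall q, P q -> forward_invariant f D q.
Hypothesis D_closed : closed D.
Hypothesis f_mono : monotone_on f D P.
Implicit Types (x y z a b l : 'rV[R]_n) (p q : 'rV[R]_m).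

Lemma complete_D x p : D x -> P p -> forward_complete f x p.
Proof. by move=> Dx /D_invariant/(_ x Dx)[]. Qed.

Lemma phi_D x p (t : R) : D x -> P p -> 0 <= t -> D (phi f t x p).
Proof. by move=> Dx /D_invariant/(_ x Dx)[_]; exact. Qed.

Lemma basin_center x p : P p -> fixed_point f x p -> basin f x p x.
Proof.
move=> Pp fx; split; first by exists (cst x); exact: fixed_point_forward_solution.
apply: (@cvg_trans _ (cst x t @[t --> +oo])); last exact: cvg_cst.
apply: near_eq_cvg; apply/near_pinftyP; exists 0 => // t /ltW t0.
by rewrite (phi_fixed_point f p (f_lip p Pp)).
Qed.

Lemma basin_shift x0 x p (t : R) : P p -> forward_complete f x p -> 0 <= t ->
  basin f x0 p (phi f t x p) -> basin f x0 p x.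
Proof.
move=> Pp cx t0 [_ hl]; split => //.
apply/cvgrPdist_lt => e e0; apply/near_pinftyP.
have /near_pinftyP[T T0 TE] : \forall s \near +oo, `|x0 - phi f s (phi f t x p) p| < e.
  by move/cvgrPdist_lt: hl; exact.
exists (T + t) => [|s sT]; first by rewrite addr_ge0.
have := TE (s - t) ltac:(lra).
by rewrite -(phiD f p (f_lip p Pp)) ?subrK//; lra.
Qed.

Lemma basin_between x0 x y z p : P p -> D x -> D y -> D z -> vle x y -> vle y z ->
  basin f x0 p x -> basin f x0 p z -> basin f x0 p y.
Proof.
move=> Pp Dx Dy Dz xy yz [_ xx0] [_ zx0]; split; first exact: complete_D.
by apply: squeeze_vle xx0 zx0 => t t0; apply: f_mono => //; exact: vle_refl.
Qed.

(* Along the segment from [x] to [y] the points of [D] belong to the basin, by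
   squeezing, and the points of the basin are interior to [D]: by connectedness
   the segment lies in the basin. *)
Lemma order_convex_basin x0 p : P p -> asymptotically_stable f x0 p ->
  basin f x0 p `<=` D -> order_convex (basin f x0 p).
Proof.
move=> Pp sx0 BD x z Bx Bz y [xy yz].
pose g (s : R) := x + s *: (y - x).
have gc : continuous g.
  move=> s; apply: cvgD; first exact: cvg_cst.
  by apply: cvgZr_tmp.
pose B' := `[0, 1]%classic `&` g @^-1` basin f x0 p.
suff : B' = `[0, 1]%classic.
  move=> B'E; have : B' 1 by rewrite B'E /= in_itv/= ler01 lexx.
  by rewrite /B' /= /g scale1r addrC subrK => -[].
apply: (@segment_connected R 0 1).
- exists 0; split; first by rewrite /= in_itv/= lexx ler01.
  by rewrite /= /g scale0r addr0.
- exists (g @^-1` basin f x0 p) => //; apply: open_comp => [s _|]; first exact: gc.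
  exact: open_basin (f_lip p Pp) _ sx0.
- exists (g @^-1` D); first by apply: (closed_comp (f := g)) => // s _; exact: gc.
  apply/seteqP; split => s [s01 gs]; split => //; first exact: BD.
  apply: (basin_between _ x (g s) z) => //; [exact: BD|exact: BD| |].
    move=> i; rewrite !mxE lerDl; move: s01; rewrite /= in_itv/= => /andP[s0 _].
    by rewrite mulr_ge0// subr_ge0.
  apply: (vle_trans y) => // i; rewrite !mxE.
  move: s01; rewrite /= in_itv/= => /andP[s0 s1].
  have := xy i; rewrite -subr_ge0 => h.
  have := ler_wpM2r h s1; rewrite mul1r; lra.
Qed.

Lemma phi_nondecreasing a p : P p -> D a ->
  (forall t : R, 0 <= t -> vle a (phi f t a p)) ->
  forall s t : R, 0 <= s -> 0 <= t -> vle (phi f s a p) (phi f (s + t) a p).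
Proof.
move=> Pp Da ha s t s0 t0.
rewrite (phiD f p (f_lip p Pp)) //; last exact: complete_D.
by apply: f_mono => //; [exact: phi_D|exact: ha].
Qed.

(** At parameter [q] the trajectory of [a] is constant, and raising the parameter can only raise
    it. *)
Lemma vle_phi a q p : P p -> P q -> vle q p -> D a -> fixed_point f a q ->
  forall t : R, 0 <= t -> vle a (phi f t a p).
Proof.
move=> Pp Pq qp Da fa t t0.
rewrite -{1}(phi_fixed_point f q (f_lip q Pq) a t fa t0).
by apply: f_mono => //; exact: vle_refl.
Qed.

End MonotoneFlow.

(** * Spectrum at equilibria attracting from below *)

Section MetzlerMatrices.
Context {R : realType} {n : nat}.

(* Taking moduli in the eigenvector equation replaces Perron-Frobenius: it gives
   a nonnegative vector that [J] expands at least by the rate [Re l]. *)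
Lemma metzler_subeigenvector (J : 'M[R]_n) (l : R[i]) :
  (forall i j, i != j -> 0 <= J i j) ->
  eigenvalue (map_mx (real_complex R) J) l ->
  exists w : 'rV[R]_n, [/\ forall i, 0 <= w 0 i, w <> 0 &
    forall j, complex.Re l * w 0 j <= (w *m J) 0 j].
Proof.
move=> J0 /eigenvalueP[v vl v0].
pose W i : R := Normc.normc (v 0 i).
have Wge0 i : 0 <= W i by rewrite -lecR; exact: (normr_ge0 (v 0 i)).
exists (\row_i W i); split.
- by move=> i; rewrite mxE.
- move=> /rowP W0; move/eqP: v0; apply; apply/rowP => i.
  by have := W0 i; rewrite !mxE => /Normc.eq0_normc.
- move=> j; rewrite !mxE.
  under eq_bigr do rewrite mxE.
  have /rowP/(_ j) := vl; rewrite !mxE (bigD1 j)//= mxE => vlj.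
  rewrite (bigD1 j)//=.
  (* The diagonal entry may be negative, so it is moved to the left before moduli are taken;
     [|l - J j j|] is at least [Re l - J j j]. *)
  have E : (l - (J j j)%:C%C) * v 0 j =
      \sum_(i < n | i != j) v 0 i * (map_mx (real_complex R) J) i j.
    by rewrite mulrBl -vlj mulrC addrAC subrr add0r.
  have h1 : Normc.normc ((l - (J j j)%:C%C) * v 0 j) <=
      \sum_(i < n | i != j) W i * J i j.
    rewrite E -lecR rmorph_sum/=.
    apply: (@le_trans _ _ (\sum_(i < n | i != j)
      `|v 0 i * (map_mx (real_complex R) J) i j|)); first exact: (@ler_norm_sum _ R[i]).
    apply: ler_sum => i ij; rewrite normrM mxE rmorphM/= ler_wpM2l ?normr_ge0//.
    have -> : `|(J i j)%:C%C| = `|J i j|%:C%C.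
      by rewrite normc_def /= expr0n/= addr0 sqrtr_sqr.
    by rewrite ger0_norm ?J0// lecR.
  have h2 : complex.Re l - J j j <= Normc.normc (l - (J j j)%:C%C).
    have := normc_ge_Re (l - (J j j)%:C%C).
    rewrite -[X in _ <= X]/((Normc.normc (l - (J j j)%:C%C))%:C)%C lecR => h.
    apply: le_trans h; apply: le_trans (ler_norm _) _.
    by rewrite raddfB/=.
  rewrite Normc.normcM -/(W j) in h1.
  have := ler_wpM2r (Wge0 j) h2; lra.
Qed.

End MetzlerMatrices.

Section StableFromBelow.
Context {R : realType} {n m : nat}.
Variable f : 'rV[R]_n -> 'rV[R]_m -> 'rV[R]_n.
Variables (P : set 'rV[R]_m) (D : set 'rV[R]_n).
Hypothesis f_lip : forall p, P p -> lipschitz_on_balls (fun x => f x p).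
Hypothesis D_invariant : forall q, P q -> forward_invariant f D q.
Hypothesis f_mono : monotone_on f D P.
Implicit Types (x y z a b l : 'rV[R]_n) (p q : 'rV[R]_m).

(** By continuity the [j]-th velocity stays negative along the trajectory for short times; the mean
    value theorem then uses derivatives at positive times, where a forward solution has them. *)
Lemma phi_coord_decreases x p j : P p -> D x -> f x p 0 j < 0 ->
  \forall t \near (0 : R)^'+, phi f t x p 0 j < x 0 j.
Proof.
move=> Pp Dx fj0.
have cx := complete_D f P D D_invariant _ _ Dx Pp.
have sx := phi_forward_solution f p x cx.
pose u t := phi f t x p; have [u0 /within_half_lineP uc uE] := sx.
have gc : {for (0 : R), continuous (fun t : R => f (u `|t|) p 0 j)}.
  apply: (@continuous_comp _ _ _ (fun t : R => f (u `|t|) p) (fun y => y 0 j)).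
    apply: (@continuous_comp _ _ _ (fun t : R => u `|t|) (fun y => f y p)).
      exact: uc.
    exact: continuous_field (f_lip p Pp) _.
  exact: coord_continuous.
have : \forall t \near (0 : R), f (u `|t|) p 0 j < 0.
  by apply: (cvgr_lt _ gc); rewrite normr0 /u u0.
move=> /nbhs_normP[d /= d0 dE]; rewrite near_withinE; apply/nbhs_normP.
exists d => //= t /=; rewrite /ball_ /= sub0r normrN => td t0; rewrite gtr0_norm// in td.
have duE (s : R) : s \in `]0, t[ -> is_derive s 1 (fun t => u t 0 j) (f (u s) p 0 j).
  rewrite in_itv/= => /andP[s0 st].
  by apply/(is_derive_rVP u _ _).1/uE.
have uci : {within `[0, t], continuous (fun t => u t 0 j)}.
  apply: (@within_continuous_coord R n _ u).
  exact: forward_solution_within sx.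
have [c] := MVT t0 duE uci.
rewrite in_itv/= => /andP[c0 ct]; rewrite /u u0 subr0 => cE.
rewrite -subr_lt0 cE pmulr_llt0//.
have := dE c; rewrite /ball_/= sub0r normrN gtr0_norm//; apply.
exact: lt_trans ct td.
Qed.

Variables (p : 'rV[R]_m) (l : 'rV[R]_n).
Hypotheses (Pp : P p) (fl : fixed_point f l p) (Dl : nbhs l D).
Hypothesis f_diff : differentiable (fun x => f x p) l.

(** As [f] vanishes at [l], the quotient of [f (l + h *: v) p] by [h] tends to the directional
    derivative, which is [v] times the Jacobian in the row convention. *)
Lemma jacobian_directional_lt0 (v : 'rV[R]_n) j :
  (v *m jacobian (fun x => f x p) l) 0 j < 0 ->
  \forall h \near (0 : R)^'+, f (l + h *: v) p 0 j < 0.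
Proof.
rewrite -deriveEjacobian// => vj.
have /cvg_rVP/(_ j) hj : h^-1 *: f (l + h *: v) p @[h --> (0 : R)^'] -->
    'D_v (fun x => f x p) l.
  have h : derivable (fun x => f x p) l v by exact: diff_derivable.
  rewrite /derivable in h.
  rewrite (_ : (fun h => h^-1 *: f (l + h *: v) p) = (fun h =>
    h^-1 *: (((fun x => f x p) \o shift l) (h *: v) - f l p))); first exact: h.
  by apply/funext => r /=; rewrite [f l p]fl subr0 addrC.
have := cvgr_lt _ hj _ vj; rewrite !near_withinE => H.
have {}H : nbhs (0 : R) (fun h : R => h != 0 -> (h^-1 *: f (l + h *: v) p) 0 j < 0).
  exact: H.
apply: (@filterS R (nbhs (0 : R)) _ _ _ _ H) => h hh h0.
have := hh ltac:(by rewrite gt_eqF); rewrite mxE.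
by rewrite pmulr_rlt0// invr_gt0.
Qed.

(** A negative entry would make coordinate [j] drop below [l 0 j] along a trajectory started at [l]
    shifted upwards in direction [i], although monotonicity keeps it above the equilibrium [l]. *)
Lemma jacobian_metzler i j : i != j -> 0 <= jacobian (fun x => f x p) l i j.
Proof.
move=> ij; rewrite leNgt; apply/negP => Jij.
pose v : 'rV[R]_n := delta_mx 0 i.
have hD : \forall h \near (0 : R)^'+, D (l + h *: v).
  exact: near_ray.
have hf : \forall h \near (0 : R)^'+, f (l + h *: v) p 0 j < 0.
  by apply: jacobian_directional_lt0; rewrite -rowE mxE.
have [h [[Dh fh] h0]] := filter_ex (filterI (filterI hD hf) (nbhs_right_gt 0)).
have ht : \forall t \near (0 : R)^'+, phi f t (l + h *: v) p 0 j < (l + h *: v) 0 j.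
  exact: phi_coord_decreases Dh fh.
have [t [tj t0]] := filter_ex (@filterI R (0 : R)^'+ _ _ _ ht (nbhs_right_gt 0)).
move: tj; apply/negP; rewrite -leNgt.
have -> : (l + h *: v) 0 j = l 0 j.
  by rewrite !mxE eqxx/= eq_sym (negbTE ij) mulr0 addr0.
rewrite -{1}(phi_fixed_point f p (f_lip p Pp) l t fl (ltW t0)).
apply: f_mono => //; [exact: nbhs_singleton|move=> k|exact: ltW].
by rewrite !mxE lerDl mulr_ge0// ltW.
Qed.

Lemma nonpositive_spectrum_stable_below :
  (exists2 r : R, 0 < r & forall w : 'rV[R]_n, (forall i, 0 <= w 0 i) -> `|w| < r ->
     phi f t (l - w) p @[t --> +oo] --> l) ->
  nonpositive_spectrum f l p.
Proof.
move=> [r r0 stable] lam ev; rewrite leNgt; apply/negP => lam0.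
have [w [w0 wn0 wJ]] := metzler_subeigenvector _ _ jacobian_metzler ev.
have [k wk] : exists k, 0 < w 0 k.
  apply: contra_notP wn0 => /forallNP nw; apply/rowP => i; rewrite mxE.
  by apply/le_anti; rewrite w0 andbT leNgt; apply/negP; exact: nw.
have hD : \forall h \near (0 : R)^'+, D (l + h *: (- w)) by exact: near_ray.
have hr : \forall h \near (0 : R)^'+, `|(l + h *: (- w)) - l| < r.
  apply: (near_ray l (- w) (fun x => `|x - l| < r)).
  by apply/nbhs_rVP; exists r => // y; rewrite distrC.
(* Where [w] is positive, [w *m J] is at least a positive multiple of [w], so the field at
   [l - h *: w] points downwards. *)
have hf : \forall h \near (0 : R)^'+, forall j, 0 < w 0 j -> f (l + h *: (- w)) p 0 j < 0.
  apply: filter_forall => j; have [wj|_] := ltP 0 (w 0 j); last exact: nearW.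
  have : \forall h \near (0 : R)^'+, f (l + h *: (- w)) p 0 j < 0.
    apply: jacobian_directional_lt0; rewrite mulNmx mxE oppr_lt0.
    by apply: lt_le_trans (wJ j); rewrite mulr_gt0.
  by apply: filterS.
have [h [[[Dz zr] fz] h0]] := filter_ex (filterI (filterI (filterI hD hr) hf)
  (nbhs_right_gt 0)).
rewrite scalerN in Dz zr fz; set z := l - h *: w in Dz zr fz.
have zl : vle z l.
  by move=> i; rewrite !mxE gerDl oppr_le0 mulr_ge0// ltW.
(* Coordinates with [w 0 j > 0] decrease strictly. Where [w 0 j = 0], [z] agrees with [l], and
   monotonicity keeps the trajectory below the equilibrium [l]. *)
have dn : \forall d \near (0 : R)^'+, forall j, phi f d z p 0 j <= z 0 j.
  apply: filter_forall => j; have [wj|wj] := ltP 0 (w 0 j).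
    have := phi_coord_decreases _ _ _ Pp Dz (fz j wj).
    by apply: filterS => t /ltW.
  near=> t; have t0 : 0 < t by near: t; exact: nbhs_right_gt.
  have -> : z 0 j = phi f t l p 0 j.
    rewrite (phi_fixed_point f p (f_lip p Pp) l t fl (ltW t0)).
    have -> : z 0 j = l 0 j - h * w 0 j by rewrite !mxE.
    by have -> : w 0 j = 0; [apply/le_anti; rewrite wj w0|rewrite mulr0 subr0].
  by apply: f_mono => //; exact: nbhs_singleton.
have [d [dz d0]] := filter_ex (@filterI R (0 : R)^'+ _ _ _ dn (nbhs_right_gt 0)).
have cz := complete_D f P D D_invariant _ _ Dz Pp.
have kz (i : nat) : vle (phi f (i%:R * d) z p) z.
  elim: i => [|i IH]; first by rewrite mul0r phi0.
  have id0 : 0 <= i%:R * d by rewrite mulr_ge0// ltW.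
  have -> : i.+1%:R * d = d + i%:R * d by rewrite mulrSr mulrDl mul1r addrC.
  rewrite (phiD f p (f_lip p Pp)) ?(ltW d0)//; apply: (vle_trans (phi f d z p)) => //.
  by apply: f_mono => //; [exact: (phi_D f P D)|exact: ltW].
have zcv : phi f t z p @[t --> +oo] --> l.
  apply: stable => [i|]; first by rewrite mxE mulr_ge0// ltW.
  by move: zr; rewrite /z addrAC subrr add0r normrN.
have hwk : z 0 k < l 0 k.
  by rewrite !mxE gtrDl oppr_lt0 mulr_gt0.
have /cvg_rVP/(_ k)/cvgr_gt/(_ _ hwk)/near_pinftyP[T T0 TE] := zcv.
(* At a multiple of [d] beyond [T], coordinate [k] is still at most [z 0 k < l 0 k], against
   convergence to [l]. *)
have := TE ((Num.truncn (T / d)).+1%:R * d); rewrite -ltr_pdivrMr//.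
move=> /(_ (truncnS_gt _)); apply/negP; rewrite -leNgt; exact: kz.
Unshelve. all: by end_near. Qed.

End StableFromBelow.

(** * Attracting intervals *)

Lemma order_interval_compact {R : realType} {n : nat} (a b : 'rV[R]_n) :
  compact (order_interval a b).
Proof.
have -> : order_interval a b =
    [set v : 'rV[R]_n | forall i, `[a 0 i, b 0 i]%classic (v ord0 i)].
  apply/seteqP; split => x.
    by move=> [ax xb] i; rewrite /= in_itv/= ax xb.
  move=> xab; split => i; by have := xab i; rewrite /= in_itv/= => /andP[].
apply: (@rV_compact _ _ (fun i => `[a 0 i, b 0 i]%classic)) => i.
exact: segment_compact.
Qed.

Section Attractors.
Context {R : realType} {n m : nat}.
Variable f : 'rV[R]_n -> 'rV[R]_m -> 'rV[R]_n.
Variables (P : set 'rV[R]_m) (D : set 'rV[R]_n).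
Hypothesis f_lip : forall p, P p -> lipschitz_on_balls (fun x => f x p).
Hypothesis D_invariant : forall q, P q -> forward_invariant f D q.
Hypothesis D_closed : closed D.
Hypothesis f_mono : strongly_monotone_on f D P.
Implicit Types (x y z a b c d l : 'rV[R]_n) (p q : 'rV[R]_m).

Let f_weak : monotone_on f D P := f_mono.1.

Lemma vle_basin a b q p : P p -> P q -> vle q p -> D a -> fixed_point f a q ->
  basin f b p a -> vle a b.
Proof.
move=> Pp Pq qp Da fa [_ ab].
apply: (@vle_cvg _ _ (cst a) (fun t => phi f t a p)) => //; last exact: cvg_cst.
by move=> t t0; exact: (vle_phi f P D f_lip f_weak a q p).
Qed.

(** Strong monotonicity separates [a] from its position at time [1], and the trajectory, being
    nondecreasing, keeps this gap in the limit. *)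
Lemma vll_limit a l q p : P p -> P q -> vlt q p -> D a -> fixed_point f a q ->
  phi f t a p @[t --> +oo] --> l -> vll a l.
Proof.
move=> Pp Pq qp Da fa al; have [qp' _] := qp.
apply: (vll_le_trans (phi f 1 a p)).
  rewrite -{1}(phi_fixed_point f q (f_lip q Pq) a 1 fa ler01).
  by apply: f_mono.2 => //; right.
have anon := phi_nondecreasing f P D f_lip D_invariant f_weak a p Pp Da
  (vle_phi f P D f_lip f_weak a q p Pp Pq qp' Da fa).
apply: (@vle_cvg _ _ (cst (phi f 1 a p)) (fun t => phi f (1 + t) a p)).
- by move=> t t0; exact: anon.
- exact: cvg_cst.
- apply/cvgrPdist_lt => e e0; apply/near_pinftyP.
  have /near_pinftyP[T T0 TE] : \forall t \near +oo, `|l - phi f t a p| < e.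
    by move/cvgrPdist_lt: al; exact.
  by exists T => // t Tt; apply: TE; lra.
Qed.

Section Interval.
Variables (q1 q2 p : 'rV[R]_m) (a b : 'rV[R]_n).
Hypotheses (Pq1 : P q1) (Pq2 : P q2) (Pp : P p).
Hypotheses (q1p : vle q1 p) (pq2 : vle p q2).
Hypotheses (a_stable : asymptotically_stable f a q1).
Hypotheses (b_stable : asymptotically_stable f b q2).
Hypotheses (basin_aD : basin f a q1 `<=` D) (basin_bD : basin f b q2 `<=` D).
Hypotheses (ab_basin : basin f b q2 a) (ba_basin : basin f a q1 b).

Let fa : fixed_point f a q1. Proof. by case: a_stable. Qed.
Let fb : fixed_point f b q2. Proof. by case: b_stable. Qed.
Let Da : D a. Proof. exact: basin_bD ab_basin. Qed.
Let Db : D b. Proof. exact: basin_aD ba_basin. Qed.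

Lemma interval_sub_basins : order_interval a b `<=` basin f a q1 `&` basin f b q2.
Proof.
move=> x abx; split.
  apply: (order_convex_basin f P D f_lip D_invariant D_closed f_weak a q1 Pq1
    a_stable basin_aD a b) => //.
  exact: (basin_center f P f_lip).
apply: (order_convex_basin f P D f_lip D_invariant D_closed f_weak b q2 Pq2
  b_stable basin_bD a b) => //.
exact: (basin_center f P f_lip).
Qed.

Lemma phi_interval x (t : R) : D x -> order_interval a b x -> 0 <= t ->
  order_interval a b (phi f t x p).
Proof.
move=> Dx [ax xb] t0; split.
  rewrite -(phi_fixed_point f q1 (f_lip q1 Pq1) a t fa t0); exact: f_weak.
rewrite -(phi_fixed_point f q2 (f_lip q2 Pq2) b t fb t0); exact: f_weak.
Qed.

Lemma interval_attractor : compact_attractor f (order_interval a b) p.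
Proof.
have sub := interval_sub_basins.
have ID x : order_interval a b x -> D x by move=> /sub[/basin_aD].
split; first exact: order_interval_compact.
  move=> x abx; split; first exact: (complete_D f P D D_invariant _ _ (ID _ abx)).
  by move=> t t0; apply: phi_interval => //; exact: ID.
exists (basin f a q1 `&` basin f b q2); split => //.
  apply: openI; first exact: (open_basin f q1 (f_lip q1 Pq1)).
  exact: (open_basin f q2 (f_lip q2 Pq2)).
move=> x [Bax Bbx]; have Dx := basin_aD _ Bax.
split; first exact: (complete_D f P D D_invariant).
move=> e e0; apply/near_pinftyP.
have [_ /cvgrPdist_lt/(_ e e0)/near_pinftyP[T1 T10 T1E]] := Bax.
have [_ /cvgrPdist_lt/(_ e e0)/near_pinftyP[T2 T20 T2E]] := Bbx.
exists (T1 + T2) => [|t tT]; first by rewrite addr_ge0.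
have t0 : 0 <= t by lra.
have ab : vle a b by exact: vle_basin Pq2 Pq1 (vle_trans _ _ _ q1p pq2) Da fa ab_basin.
(* The coordinatewise projection of the trajectory onto [[a, b]]. It is within [e], since the
   trajectory lies between those for [q1] and [q2], which are themselves within [e] of [a] and
   [b]. *)
pose y : 'rV[R]_n := \row_i Num.max (a 0 i) (Num.min (b 0 i) (phi f t x p 0 i)).
exists y.
  split => i; rewrite mxE; first by rewrite le_max lexx.
  by rewrite ge_max ab ge_min lexx.
rewrite mx_norm_ball /ball_ /=; apply: rV_norm_lt => // i; rewrite !mxE.
have hle : phi f t x q1 0 i <= phi f t x p 0 i by apply: f_weak => //; exact: vle_refl.
have hri : phi f t x p 0 i <= phi f t x q2 0 i by apply: f_weak => //; exact: vle_refl.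
have h1 := le_lt_trans (coord_le_norm _ i) (T1E t ltac:(lra)).
have h2 := le_lt_trans (coord_le_norm _ i) (T2E t ltac:(lra)).
have abi := ab i.
move: h1 h2; rewrite !mxE !ltr_norml => /andP[h1 h1'] /andP[h2 h2'].
case: (leP (b 0 i) (phi f t x p 0 i)) => ?.
  by rewrite max_r//; apply/andP; split; lra.
by case: (leP (a 0 i) (phi f t x p 0 i)) => ?; apply/andP; split; lra.
Qed.

Lemma interval_fixed_point : (forall x, differentiable (fun z => f z p) x) ->
  exists x, [/\ order_interval a b x, fixed_point f x p & nonpositive_spectrum f x p].
Proof.
move=> df.
have sub := interval_sub_basins.
have ID x : order_interval a b x -> D x by move=> /sub[/basin_aD].
have ab : vle a b by exact: vle_basin Pq2 Pq1 (vle_trans _ _ _ q1p pq2) Da fa ab_basin.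
have aphi := vle_phi f P D f_lip f_weak a q1 p Pp Pq1 q1p Da fa.
have aab : order_interval a b a by split=> //; exact: vle_refl.
have [l al lub] : exists2 l, phi f t a p @[t --> +oo] --> l &
    forall t : R, 0 <= t -> vle (phi f t a p) l.
  apply: (@nondecreasing_vle_cvg _ _ _ b) => [s t|t t0].
    exact: (phi_nondecreasing f P D f_lip D_invariant f_weak).
  by have [] := phi_interval a t Da aab t0.
have lab : order_interval a b l.
  split; first by apply: (vle_trans _ _ _ (aphi 0 (lexx _))); exact: lub.
  apply: (@vle_cvg _ _ (fun t => phi f t a p) (cst b)) => //; last exact: cvg_cst.
  by move=> t t0; have [] := phi_interval a t Da aab t0.
have ca := complete_D f P D D_invariant _ _ Da Pp.
have fl : fixed_point f l p := limit_fixed_point f p (f_lip p Pp) a l ca al.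
have Dnl : nbhs l D.
  have [Bl _] := sub _ lab.
  apply: filterS basin_aD _.
  exact: (open_nbhs_nbhs (conj (open_basin f q1 (f_lip q1 Pq1) _ a_stable) Bl)).
exists l; split => //.
apply: (nonpositive_spectrum_stable_below f P D f_lip D_invariant f_weak p l) => //.
(* If [q1 = p], the limit is [a] itself, whose basin supplies the attraction from below. Otherwise
   [l] exceeds [a] in every coordinate, so for small [w >= 0] the point [l - w] lies in [[a, l]] and
   is squeezed between the trajectory of [a] and the equilibrium [l]. *)
have [pE|pN] := eqVneq q1 p.
  have la : l = a.
    apply: cvg_unique al _ => //; rewrite -pE.
    by have [] := basin_center f P f_lip a q1 Pq1 fa.
  have [_ _ /nbhs_rVP[r r0 rE]] := a_stable.
  exists r => // w w0 wr; rewrite la -pE.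
  by apply rE; rewrite opprD addNKr opprK.
have al' : vll a l.
  by apply: (vll_limit a l q1 p) => //; split => // /eqP; exact/negP.
have /nbhs_rVP[r r0 rE] := near_vll_left _ _ al'.
exists r => // w w0 wr.
have alw : vle a (l - w).
  by apply: vllW; apply: rE; rewrite opprD addNKr opprK.
have lwl : vle (l - w) l by move=> i; rewrite !mxE gerDl oppr_le0.
have Dl : D l by exact: ID.
have Dlw : D (l - w).
  by apply: ID; split => //; apply: (vle_trans l) => //; case: lab.
apply: (@squeeze_vle _ _ (fun t => phi f t a p) _ (cst l)) => //; last exact: cvg_cst.
  by move=> t t0; apply: f_weak => //; exact: vle_refl.
move=> t t0; rewrite /cst -{2}(phi_fixed_point f p (f_lip p Pp) l t fl t0).
by apply: f_weak => //; exact: vle_refl.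
Qed.

End Interval.

End Attractors.

(** * Upper equilibria [c] of [q1] and [d] of [q2], with lower equilibria [a] and [b]
    respectively *)

Section UpperBranch.
Context {R : realType} {n m : nat}.
Variable f : 'rV[R]_n -> 'rV[R]_m -> 'rV[R]_n.
Variables (P : set 'rV[R]_m) (D : set 'rV[R]_n).
Hypothesis f_lip : forall p, P p -> lipschitz_on_balls (fun x => f x p).
Hypothesis D_invariant : forall q, P q -> forward_invariant f D q.
Hypothesis f_mono : strongly_monotone_on f D P.
Variables (q1 q2 : 'rV[R]_m) (a b c d : 'rV[R]_n).
Hypotheses (Pq1 : P q1) (Pq2 : P q2) (q12 : vlt q1 q2).
Hypotheses (c_stable : asymptotically_stable f c q1).
Hypotheses (d_stable : asymptotically_stable f d q2).
Hypotheses (basin_cD : basin f c q1 `<=` D) (basin_dD : basin f d q2 `<=` D).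

Let f_weak : monotone_on f D P := f_mono.1.
Let fc : fixed_point f c q1. Proof. by case: c_stable. Qed.
Let nbhs_cD : nbhs c D.
Proof. by have [_ _] := c_stable; exact: filterS. Qed.
Let Dc : D c. Proof. exact: nbhs_singleton. Qed.
Let nbhs_dD : nbhs d D.
Proof. by have [_ _] := d_stable; exact: filterS. Qed.
Let Dd : D d. Proof. exact: nbhs_singleton. Qed.

(* [c] itself might lie on the common boundary of the two basins, but its
   trajectory immediately moves to a point [y >> c], which is trapped between
   points of the basin of [d]. *)
Lemma lower_in_upper_basin : D `<=` closure (basin f b q2 `|` basin f d q2) ->
  basin f b q2 `<=` D -> ~ vle c b -> basin f d q2 c.
Proof.
move=> Dcl basin_bD ncb; have [q12' _] := q12.
(* A point of the basin of [b] above [c] would have its limit above [c], since [c] is at rest for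
   [q1] and [q1 <= q2]; this contradicts [~ vle c b]. *)
have above w : basin f b q2 w \/ basin f d q2 w -> vle c w -> basin f d q2 w.
  move=> [Bw cw|//]; exfalso; apply: ncb; have Dw := basin_bD _ Bw; have [_ wb] := Bw.
  apply: (@vle_cvg _ _ (cst c) (fun t => phi f t w q2)) => //; last exact: cvg_cst.
  move=> t t0; rewrite /cst -{1}(phi_fixed_point f q1 (f_lip q1 Pq1) c t fc t0).
  exact: f_weak.
(* The two basins are together dense in [D], so a neighbourhood of a point of [D] that lies above
   [c] meets the basin of [d]. *)
have find w (A : set 'rV[R]_n) : D w -> nbhs w A -> (A `<=` [set x | vle c x]) ->
    exists2 x, A x & basin f d q2 x.
  move=> /Dcl clw wA Ac; have [x [Bx Ax]] := clw _ wA.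
  by exists x => //; apply: above => //; exact: Ac.
have cc := complete_D f P D D_invariant _ _ Dc Pq2.
have /nbhs_rVP[r r0 rD] := nbhs_cD.
have [t [t0 tr]] : exists t : R, 0 < t /\ `|c - phi f t c q2| < r / 2.
  have [u0 /within_half_lineP uc _] := phi_forward_solution f q2 c cc.
  have r2 : 0 < r / 2 by rewrite divr_gt0.
  have : \forall t \near (0 : R), `|c - phi f `|t| c q2| < r / 2.
    have := uc 0; rewrite /continuous_at normr0 u0 => /cvgrPdist_lt; exact.
  move=> /nbhs_normP[e /= e0 eE]; exists (e / 2); split; first by rewrite divr_gt0.
  have := eE (e / 2); rewrite /ball_/= sub0r normrN gtr0_norm ?divr_gt0//; apply; lra.
pose y := phi f t c q2.
have Dy : D y by apply: (phi_D f P D D_invariant) => //; exact: ltW.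
have cy : vll c y.
  rewrite -(phi_fixed_point f q1 (f_lip q1 Pq1) c t fc (ltW t0)).
  by apply: f_mono.2 => //; right.
(* On this ray from [c] through [y], the parameters [1/2] and [2] give points strictly below and
   above [y]. As [y] is within [r / 2] of [c], the ray stays in [D] up to parameter [2]. *)
pose ray (s : R) : 'rV[R]_n := c + s *: (y - c).
have rayD s : 0 <= s -> s <= 2 -> D (ray s).
  move=> s0 s2; apply: rD; rewrite opprD addNKr normrN normrZ ger0_norm// distrC.
  have := ler_wpM2r (normr_ge0 (c - y)) s2; rewrite /y in tr *; lra.
have rayE s i : ray s 0 i = c 0 i + s * (y 0 i - c 0 i) by rewrite !mxE.
have [w [cw wy] Bw] : exists2 w, vll c w /\ vll w y & basin f d q2 w.
  apply: (find (ray 2^-1)); first by apply: rayD; lra.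
    apply: filterI; [apply: near_vll_left|apply: near_vll_right] => i;
      have := cy i; rewrite rayE; lra.
  by move=> x [cx _]; exact: vllW.
have [w' yw' Bw'] : exists2 w, vll y w & basin f d q2 w.
  apply: (find (ray 2)); first by apply: rayD; lra.
    by apply: near_vll_left => i; have := cy i; rewrite rayE; lra.
  by move=> x yx; apply: (vle_trans y); exact: vllW.
apply: (basin_shift f P f_lip d c q2 t) => //; first exact: ltW.
apply: (basin_between f P D D_invariant f_weak d w y w') => //.
- exact: basin_dD.
- exact: basin_dD.
- exact: vllW.
- exact: vllW.
Qed.

(** Strong monotonicity places [d] strictly above [c], and by density some [w] strictly above [d]
    lies in a basin for [q1]. Convergence of [w] to [a] would give [c <= a], hence [a = c]; so [w]
    is in the basin of [c], and [d] is trapped between [c] and [w]. *)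
Lemma upper_in_lower_basin : D `<=` closure (basin f a q1 `|` basin f c q1) ->
  basin f a q1 `<=` D -> vle a c -> a <> c -> basin f d q2 c -> basin f c q1 d.
Proof.
move=> Dcl basin_aD ac a_neq_c Bc; have [q12' _] := q12; have [_ cd] := Bc.
have cd' : vll c d := vll_limit f P D f_lip D_invariant f_mono c d q1 q2
  Pq2 Pq1 q12 Dc fc cd.
have nD : \forall h \near (0 : R)^'+, D (d + h *: (d - c)) by exact: near_ray.
have [h [Dh h0]] := filter_ex (@filterI R (0 : R)^'+ _ _ _ nD (nbhs_right_gt 0)).
have nA : \forall x \near d + h *: (d - c), vll d x.
  apply: near_vll_left => i; rewrite !mxE ltrDl mulr_gt0// subr_gt0; exact: cd'.
have [w [Bw dw]] := Dcl _ Dh _ nA.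
have cw : vle c w by apply: (vle_trans d); exact: vllW.
have {}Bw : basin f c q1 w.
  case: Bw => // Bw; exfalso; apply: a_neq_c; apply: vle_anti ac _.
  have Dw := basin_aD _ Bw; have [_ wa] := Bw.
  apply: (@vle_cvg _ _ (cst c) (fun t => phi f t w q1)) => //; last exact: cvg_cst.
  move=> t t0; rewrite /cst -{1}(phi_fixed_point f q1 (f_lip q1 Pq1) c t fc t0).
  by apply: f_weak => //; exact: vle_refl.
apply: (basin_between f P D D_invariant f_weak c c d w) => //.
- exact: basin_cD.
- exact: vllW.
- exact: vllW.
- exact: (basin_center f P f_lip).
Qed.

End UpperBranch.

Theorem proposition9 (R : realType) (n m : nat)
  (f : 'rV[R]_n -> 'rV[R]_m -> 'rV[R]_n)
  (P : set 'rV[R]_m) (D : set 'rV[R]_n)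
  (P_convex : order_convex P)
  (f_cont : {within [set: 'rV[R]_n] `*` P,
               continuous (fun z : 'rV[R]_n * 'rV[R]_m => f z.1 z.2)})
  (f_C2 : forall p, P p -> twice_continuously_differentiable (fun x => f x p))
  (D_state_space : forall q, P q -> forward_invariant f D q)
  (f_mono : strongly_monotone_on f D P)
  (pmin pmax : 'rV[R]_m) (P_pmin : P pmin) (P_pmax : P pmax)
  (xs xb : 'rV[R]_m -> 'rV[R]_n)
  (bistable : forall p, p = pmin \/ p = pmax ->
     [/\ D (xs p) /\ D (xb p),
         asymptotically_stable f (xs p) p /\ asymptotically_stable f (xb p) p,
         xs p <> xb p,
         D = closure (basin f (xs p) p `|` basin f (xb p) p) &
         vle (xs p) (xb p)])
  (diag : forall p, p = pmin \/ p = pmax ->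
     diagonalizable_jacobian f (xs p) p /\ diagonalizable_jacobian f (xb p) p)
  (xs_pmin_basin : basin f (xs pmax) pmax (xs pmin))
  (xs_pmax_basin : basin f (xs pmin) pmin (xs pmax))
  (xb_pmin_notin : ~ order_interval (xs pmin) (xs pmax) (xb pmin)) :
  forall p, order_interval pmin pmax p ->
    [/\ compact_attractor f (order_interval (xs pmin) (xs pmax)) p,
        compact_attractor f (order_interval (xb pmin) (xb pmax)) p,
        exists x, [/\ order_interval (xs pmin) (xs pmax) x,
                      fixed_point f x p & nonpositive_spectrum f x p] &
        exists x, [/\ order_interval (xb pmin) (xb pmax) x,
                      fixed_point f x p & nonpositive_spectrum f x p]].
Proof.
move=> p [minp pmaxp].
have Pp : P p by exact: P_convex P_pmin P_pmax _ _.
have f_lip q : P q -> lipschitz_on_balls (fun x => f x q).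
  by move=> /f_C2; exact: C2_lipschitz_on_balls.
have df x : differentiable (fun z => f z p) x by have [] := f_C2 p Pp.
have [_ [xs1 xb1] neq1 D1 le1] := bistable pmin (or_introl erefl).
have [_ [xs2 xb2] _ D2 _] := bistable pmax (or_intror erefl).
have D_closed : closed D by rewrite D1; exact: closed_closure.
have xs1D : basin f (xs pmin) pmin `<=` D.
  by rewrite D1 => x Bx; apply: subset_closure; left.
have xb1D : basin f (xb pmin) pmin `<=` D.
  by rewrite D1 => x Bx; apply: subset_closure; right.
have xs2D : basin f (xs pmax) pmax `<=` D.
  by rewrite D2 => x Bx; apply: subset_closure; left.
have xb2D : basin f (xb pmax) pmax `<=` D.
  by rewrite D2 => x Bx; apply: subset_closure; right.
have [xb_pmin_basin xb_pmax_basin] : basin f (xb pmax) pmax (xb pmin) /\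
    basin f (xb pmin) pmin (xb pmax).
  (* For equal parameters the two upper equilibria coincide, and the equilibrium is in its own
     basin. *)
  have [E|NE] := eqVneq pmin pmax.
    by rewrite -E; split; apply: (basin_center f P f_lip) => //; case: xb1.
  have q12 : vlt pmin pmax.
    by split; [exact: vle_trans minp pmaxp|exact/eqP].
  have up : basin f (xb pmax) pmax (xb pmin).
    apply: (lower_in_upper_basin f P D f_lip D_state_space f_mono pmin pmax
      (xs pmax)) => //; first by rewrite -D2.
    (* As [xs pmin <= xb pmin], the inequality [xb pmin <= xs pmax] would put [xb pmin] in the
       excluded interval. *)
    by move=> h; apply: xb_pmin_notin.
  split; first exact: up.
  apply: (upper_in_lower_basin f P D f_lip D_state_space f_mono pmin pmax
    (xs pmin)) => //; by rewrite -D1.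
split.
- exact: (interval_attractor f P D f_lip D_state_space D_closed f_mono pmin pmax).
- exact: (interval_attractor f P D f_lip D_state_space D_closed f_mono pmin pmax).
- exact: (interval_fixed_point f P D f_lip D_state_space D_closed f_mono pmin pmax).
- exact: (interval_fixed_point f P D f_lip D_state_space D_closed f_mono pmin pmax).
Qed.
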